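(* Let $\mathfrak{t}$ be a triangulation of the $\infty$-gon. (a) If $\mathfrak{t}$ is locally finite, then $\mathfrak{t}$ yields a quantum cluster algebra structure on the whole doubly-infinite quantum Grassmannian $\mathbb{C}_q[\mathrm{Gr}(2,\pm\infty)]$, where the $\Delta_q^{i,i+1}$ for $i\in\mathbb{Z}$ are coefficients. (b) If $\mathfrak{t}$ has a fountain $k$, then $\mathfrak{t}$ yields a quantum cluster algebra structure on the subalgebra of $\mathbb{C}_q[\mathrm{Gr}(2,\pm\infty)]$ generated by the quantum Plücker coordinates $\{\Delta_q^{ij}\mid i<j\le k \text{ or } k\le i<j\}$, where the $\Delta_q^{i,i+1}$ for $i\in\mathbb{Z}$ are coefficients. (c) If $\mathfrak{t}$ has a split fountain with left-fountain $l$ and right-fountain $r$, then $\mathfrak{t}$ yields a quantum cluster algebra structure on the subalgebra of $\mathbb{C}_q[\mathrm{Gr}(2,\pm\infty)]$ generated by the quantum Plücker coordinates $\{\Delta_q^{ij}\mid i<j\le l \text{ or } l\le i<j\le r \text{ or } r\le i<j\}$, where the $\Delta_q^{i,i+1}$ for $i\in\mathbb{Z}$ as well as $\Delta_q^{lr}$ are coefficients.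
   Context: The $\infty$-gon is the line of integers $\mathbb{Z}$. An arc is a pair of integers $(m,n)$ with $m\le n-2$; a side is a pair $(n,n+1)$. Arcs $(i,j)$ and $(m,n)$ intersect if $i<m<j<n$ or $m<i<n<j$. A triangulation is a maximal set of pairwise non-intersecting arcs. A triangulation $\mathfrak{t}$ is locally finite if for every integer $n$ only finitely many arcs of $\mathfrak{t}$ have $n$ as an endpoint. An integer $n$ is a right-fountain (resp. left-fountain) of $\mathfrak{t}$ if $\mathfrak{t}$ contains infinitely many arcs of the form $(n,p)$ (resp. $(m,n)$), and a fountain if it is both. $\mathfrak{t}$ has a split fountain if it has a left-fountain $l$ and a right-fountain $r$ with $l\neq r$. An arc of $\mathfrak{t}$ is mutable unless it is the arc $(l,r)$ of a split fountain; sides, and $(l,r)$ in the split fountain case, are frozen. Let $q\in\mathbb{C}$ be non-zero, with a fixed square root $q^{1/2}$. $\mathbb{C}_q[M(2,\pm\infty)]$ is the $\mathbb{C}$-algebra generated by $X_{1j},X_{2j}$, $j\in\mathbb{Z}$, subject to: $X_{ki}X_{kj}=qX_{kj}X_{ki}$ ($k=1,2$, $i<j$); $X_{1i}X_{2i}=qX_{2i}X_{1i}$ (all $i$); $X_{1j}X_{2i}=X_{2i}X_{1j}$ and $X_{1i}X_{2j}-X_{2j}X_{1i}=(q-q^{-1})X_{1j}X_{2i}$ ($i<j$). $\mathbb{C}_q[\mathrm{Gr}(2,\pm\infty)]$ is its subalgebra generated by the quantum Plücker coordinates $\Delta_q^{ij}=X_{1i}X_{2j}-qX_{1j}X_{2i}$,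 $i<j$. It is a domain, and computations with inverses take place in its skew-field of fractions. Exchange quiver $Q_{\mathfrak{t}}$: vertices are the arcs of $\mathfrak{t}$ and all sides; for every triple $i<j<k$ such that each of $(i,j),(j,k),(i,k)$ is an arc of $\mathfrak{t}$ or a side, there are arrows $(i,j)\to(i,k)\to(j,k)\to(i,j)$, arrows between two frozen vertices being discarded. The exchange matrix $B$ has rows indexed by arcs of $\mathfrak{t}$ and sides, columns indexed by mutable arcs, and $B_{a,b}=\#\{a\to b\}-\#\{b\to a\}$. The matrix $L$ has rows and columns indexed by arcs of $\mathfrak{t}$ and sides and records $\Delta_q^{ij}\Delta_q^{kl}=q^{L_{(i,j),(k,l)}}\Delta_q^{kl}\Delta_q^{ij}$; explicitly $L_{(i,j),(k,l)}$ is: $0$ if $i=k<j=l$, or $i<k<l<j$, or $k<i<j<l$; $1$ if $i<k<j=l$, or $i=k<j<l$, or $i<j=k<l$; $-1$ if $k<i<j=l$, or $i=k<l<j$, or $k<l=i<j$; $2$ if $i<j<k<l$; $-2$ if $k<l<i<j$. Quantum seeds and mutation (Berenstein–Zelevinsky): a quantum seed is a triple $(\{x_a\},B,L)$ with $x_ax_b=q^{L_{ab}}x_bx_a$, $L$ skew-symmetric, the $x_a$ generating a quantum torus, $B$ with finitely many nonzero entries in each column, and $(B^TL)_{b,a}=d\,\delta_{b,a}$ for some positive integer $d$ (all mutable $b$, all $a$). For a finitely supported integer vector $(a_v)$ and a total order on the indices set $M((a_v))=q^{\frac12\sum_{u<v}a_ua_vL_{vu}}\prod_v x_v^{a_v}$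 (ordered product; the result does not depend on the order). Mutation at a mutable index $b$ keeps $x_a$ for $a\ne b$ and replaces $x_b$ by $x_b'=M(-e_b+\sum_{B_{ab}>0}B_{ab}e_a)+M(-e_b-\sum_{B_{ab}<0}B_{ab}e_a)$, where $e_a$ are standard basis vectors; $B$ is replaced by its Fomin–Zelevinsky matrix mutation at $b$; and $L$ is replaced by $L'$ with $L'_{ac}=L_{ac}$ for $a,c\neq b$ and $L'_{bc}=-L'_{cb}=-L_{bc}+\sum_{B_{ab}>0}B_{ab}L_{ac}$ for $c\ne b$. Only finite sequences of mutations are allowed. The elements of all clusters so obtained are the quantum cluster variables; those at frozen indices are the coefficients (not inverted). ''$\mathfrak{t}$ yields a quantum cluster algebra structure on $R$'' means that $(\{\Delta_q^{ij}\},B,L)$, with $(i,j)$ ranging over the arcs of $\mathfrak{t}$ and the sides, is a quantum seed (with the stated coefficients as frozen variables), and that the $\mathbb{C}$-algebra generated by all quantum cluster variables (including coefficients) obtained from it is equal to $R$. *)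

(* Defs.v *)
From HB Require Import structures.
From mathcomp Require Import all_boot all_order all_algebra.
From mathcomp Require Import generic_quotient finmap.
From mathcomp Require Import mathcomp_extra boolp classical_sets functions.
From mathcomp Require Import cardinality fsbigop reals.
From mathcomp Require Import complex.

Set Implicit Arguments.
Unset Strict Implicit.
Unset Printing Implicit Defensive.

Import Order.TTheory GRing.Theory Num.Theory.

Local Open Scope classical_set_scope.
Local Open Scope quotient_scope.
Local Open Scope ring_scope.

(* Formal expressions in generators X_{ki}, k = 1, 2 (ord0 and ord_max below), *)
(* i : int, and constants from K. The algebra qmat q of quantum 2 x oo        *)
(* matrices is their quotient by qmat_eq q.                                   *)
Inductive qmat_term (K : Type) : Type :=
| TGen of 'I_2 & int
| TCst of K
| TAdd of qmat_term K & qmat_term K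
| TMul of qmat_term K & qmat_term K.

Arguments TGen {K}.

HB.instance Definition _ (K : Type) := gen_eqMixin (qmat_term K).
HB.instance Definition _ (K : Type) := gen_choiceMixin (qmat_term K).

Local Notation X1 := (TGen ord0).
Local Notation X2 := (TGen ord_max).

(* The least congruence on formal expressions containing the axioms of unital *)
(* associative K-algebras (first block) and the quantum matrix relations.     *)
(* Since there is no subtraction symbol, the last relation is written         *)
(*   X_{1i} X_{2j} = X_{2j} X_{1i} + (q - q^-1) X_{1j} X_{2i}.                *)
Inductive qmat_eq (K : fieldType) (q : K) :
  qmat_term K -> qmat_term K -> Prop :=
| QRefl x : qmat_eq q x x
| QSym x y : qmat_eq q x y -> qmat_eq q y x
| QTrans x y z : qmat_eq q x y -> qmat_eq q y z -> qmat_eq q x z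
| QAdd x x' y y' : qmat_eq q x x' -> qmat_eq q y y' ->
    qmat_eq q (TAdd x y) (TAdd x' y')
| QMul x x' y y' : qmat_eq q x x' -> qmat_eq q y y' ->
    qmat_eq q (TMul x y) (TMul x' y')
| QAddA x y z : qmat_eq q (TAdd x (TAdd y z)) (TAdd (TAdd x y) z)
| QAddC x y : qmat_eq q (TAdd x y) (TAdd y x)
| QAdd0 x : qmat_eq q (TAdd (TCst 0) x) x
| QAddN x : qmat_eq q (TAdd (TMul (TCst (-1)) x) x) (TCst 0)
| QMulA x y z : qmat_eq q (TMul x (TMul y z)) (TMul (TMul x y) z)
| QMul1l x : qmat_eq q (TMul (TCst 1) x) x
| QMul1r x : qmat_eq q (TMul x (TCst 1)) x
| QMulDl x y z : qmat_eq q (TMul (TAdd x y) z) (TAdd (TMul x z) (TMul y z))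
| QMulDr x y z : qmat_eq q (TMul x (TAdd y z)) (TAdd (TMul x y) (TMul x z))
| QCstD a b : qmat_eq q (TCst (a + b)) (TAdd (TCst a) (TCst b))
| QCstM a b : qmat_eq q (TCst (a * b)) (TMul (TCst a) (TCst b))
| QCstC a x : qmat_eq q (TMul (TCst a) x) (TMul x (TCst a))
| QRow (k : 'I_2) (i j : int) : i < j ->
    qmat_eq q (TMul (TGen k i) (TGen k j))
              (TMul (TCst q) (TMul (TGen k j) (TGen k i)))
| QCol (i : int) :
    qmat_eq q (TMul (X1 i) (X2 i)) (TMul (TCst q) (TMul (X2 i) (X1 i)))
| QAnti (i j : int) : i < j ->
    qmat_eq q (TMul (X1 j) (X2 i)) (TMul (X2 i) (X1 j))
| QDiag (i j : int) : i < j ->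
    qmat_eq q (TMul (X1 i) (X2 j))
              (TAdd (TMul (X2 j) (X1 i))
                    (TMul (TCst (q - q^-1)) (TMul (X1 j) (X2 i)))).

Section QuantumMatrices.
Context {K : fieldType}.
Implicit Types (q a b : K).

Definition qmat_eqb q (x y : qmat_term K) : bool := `[< qmat_eq q x y >].

Lemma qmat_eqb_refl q : reflexive (qmat_eqb q).
Proof. by move=> x; apply/asboolP; exact: QRefl. Qed.

Lemma qmat_eqb_sym q : symmetric (qmat_eqb q).
Proof. by move=> x y; apply/asboolP/asboolP; exact: QSym. Qed.

Lemma qmat_eqb_trans q : transitive (qmat_eqb q).
Proof.
by move=> y x z /asboolP xy /asboolP yz; apply/asboolP; exact: QTrans xy yz.
Qed.

Definition qmat_equiv q :=
  EquivRel (qmat_eqb q) (qmat_eqb_refl q) (qmat_eqb_sym q) (@qmat_eqb_trans q).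

Definition qmat q : Type := {eq_quot (qmat_equiv q)}%qT.

HB.instance Definition _ q := Choice.on (qmat q).
HB.instance Definition _ q := EqQuotient.on (qmat q).

Definition qmat_class q (x : qmat_term K) : qmat q := \pi_(qmat q) x.

Lemma qmat_classP q x y : qmat_class q x = qmat_class q y <-> qmat_eq q x y.
Proof. by split=> [/eqmodP/asboolP//|xy]; apply/eqmodP/asboolP. Qed.

Lemma qmat_class_repr q (x : qmat q) : qmat_class q (repr x) = x.
Proof. exact: reprK. Qed.

Definition qmat_cst q a := qmat_class q (TCst a).
Definition qmat_add q (x y : qmat q) := qmat_class q (TAdd (repr x) (repr y)).
Definition qmat_mul q (x y : qmat q) := qmat_class q (TMul (repr x) (repr y)).
Definition qmat_opp q (x : qmat q) := qmat_mul (qmat_cst q (-1)) x.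
Definition qmat_scale q a (x : qmat q) := qmat_mul (qmat_cst q a) x.

Lemma qmat_class_add q x y :
  qmat_add (qmat_class q x) (qmat_class q y) = qmat_class q (TAdd x y).
Proof. by apply/qmat_classP; apply: QAdd; apply/qmat_classP; exact: reprK. Qed.

Lemma qmat_class_mul q x y :
  qmat_mul (qmat_class q x) (qmat_class q y) = qmat_class q (TMul x y).
Proof. by apply/qmat_classP; apply: QMul; apply/qmat_classP; exact: reprK. Qed.

Let qmatW q (P : qmat q -> Prop) :
  (forall x, P (qmat_class q x)) -> forall x, P x.
Proof. by move=> h x; rewrite -(qmat_class_repr x). Qed.

Let qmatE := (qmat_class_add, qmat_class_mul).

Lemma qmat_addA q : associative (@qmat_add q).
Proof.
elim/qmatW=> x; elim/qmatW=> y; elim/qmatW=> z.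
by rewrite !qmatE; apply/qmat_classP/QAddA.
Qed.

Lemma qmat_addC q : commutative (@qmat_add q).
Proof.
by elim/qmatW=> x; elim/qmatW=> y; rewrite !qmatE; apply/qmat_classP/QAddC.
Qed.

Lemma qmat_add0 q : left_id (qmat_cst q 0) (@qmat_add q).
Proof. by elim/qmatW=> x; rewrite !qmatE; apply/qmat_classP/QAdd0. Qed.

Lemma qmat_addN q : left_inverse (qmat_cst q 0) (@qmat_opp q) (@qmat_add q).
Proof.
by elim/qmatW=> x; rewrite /qmat_opp /qmat_cst !qmatE; apply/qmat_classP/QAddN.
Qed.

HB.instance Definition _ q := GRing.isZmodule.Build (qmat q)
  (@qmat_addA q) (@qmat_addC q) (@qmat_add0 q) (@qmat_addN q).

Lemma qmat_mulA q : associative (@qmat_mul q).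
Proof.
elim/qmatW=> x; elim/qmatW=> y; elim/qmatW=> z.
by rewrite !qmatE; apply/qmat_classP/QMulA.
Qed.

Lemma qmat_mul1l q : left_id (qmat_cst q 1) (@qmat_mul q).
Proof. by elim/qmatW=> x; rewrite !qmatE; apply/qmat_classP/QMul1l. Qed.

Lemma qmat_mul1r q : right_id (qmat_cst q 1) (@qmat_mul q).
Proof. by elim/qmatW=> x; rewrite !qmatE; apply/qmat_classP/QMul1r. Qed.

Lemma qmat_mulDl q : left_distributive (@qmat_mul q) +%R.
Proof.
elim/qmatW=> x; elim/qmatW=> y; elim/qmatW=> z.
by rewrite /GRing.add /= !qmatE; apply/qmat_classP/QMulDl.
Qed.

Lemma qmat_mulDr q : right_distributive (@qmat_mul q) +%R.
Proof.
elim/qmatW=> x; elim/qmatW=> y; elim/qmatW=> z.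
by rewrite /GRing.add /= !qmatE; apply/qmat_classP/QMulDr.
Qed.

(* Evaluation at the zero matrix, used only to see that 1 != 0 in qmat q.     *)
Fixpoint qmat_augment (x : qmat_term K) : K :=
  match x with
  | TGen _ _ => 0
  | TCst a => a
  | TAdd x y => qmat_augment x + qmat_augment y
  | TMul x y => qmat_augment x * qmat_augment y
  end.

Lemma qmat_augmentP q x y :
  qmat_eq q x y -> qmat_augment x = qmat_augment y.
Proof.
elim=> //= {x y}.
- by move=> x y z _ -> _ ->.
- by move=> x x' y y' _ -> _ ->.
- by move=> x x' y y' _ -> _ ->.
- by move=> *; rewrite addrA.
- by move=> *; rewrite addrC.
- by move=> *; rewrite add0r.
- by move=> *; rewrite mulN1r addNr.
- by move=> *; rewrite mulrA.
- by move=> *; rewrite mul1r.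
- by move=> *; rewrite mulr1.
- by move=> *; rewrite mulrDl.
- by move=> *; rewrite mulrDr.
- by move=> *; rewrite mulrC.
- by move=> *; rewrite !mulr0.
- by move=> *; rewrite !mulr0.
- by move=> *; rewrite !mulr0 addr0.
Qed.

Lemma qmat_one_neq0 q : qmat_cst q 1 != 0.
Proof.
apply/eqP => /qmat_classP/qmat_augmentP /= /eqP.
by rewrite oner_eq0.
Qed.

HB.instance Definition _ q := GRing.Zmodule_isNzRing.Build (qmat q)
  (@qmat_mulA q) (@qmat_mul1l q) (@qmat_mul1r q) (@qmat_mulDl q)
  (@qmat_mulDr q) (qmat_one_neq0 q).

Lemma qmat_scaleA q a b (x : qmat q) :
  qmat_scale a (qmat_scale b x) = qmat_scale (a * b) x.
Proof.
rewrite /qmat_scale qmat_mulA; congr qmat_mul.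
by rewrite /qmat_cst qmatE; apply/qmat_classP/QSym/QCstM.
Qed.

Lemma qmat_scale1 q : left_id 1 (@qmat_scale q).
Proof. exact: qmat_mul1l. Qed.

Lemma qmat_scaleDr q : right_distributive (@qmat_scale q) +%R.
Proof. by move=> a x y; exact: qmat_mulDr. Qed.

Lemma qmat_scaleDl q (x : qmat q) :
  {morph (@qmat_scale q)^~ x : a b / a + b}.
Proof.
move=> a b; rewrite /= /qmat_scale -qmat_mulDl; congr qmat_mul.
by rewrite /GRing.add /= /qmat_cst qmatE; apply/qmat_classP/QCstD.
Qed.

HB.instance Definition _ q := GRing.Zmodule_isLmodule.Build K (qmat q)
  (@qmat_scaleA q) (@qmat_scale1 q) (@qmat_scaleDr q) (@qmat_scaleDl q).

Lemma qmat_scaleAl q a (x y : qmat q) : a *: (x * y) = a *: x * y.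
Proof. exact: qmat_mulA. Qed.

HB.instance Definition _ q := GRing.Lmodule_isLalgebra.Build K (qmat q)
  (@qmat_scaleAl q).

Lemma qmat_scaleAr q a (x y : qmat q) : a *: (x * y) = x * (a *: y).
Proof.
rewrite /GRing.scale /= /qmat_scale.
change (qmat_mul (qmat_cst q a) (qmat_mul x y) =
        qmat_mul x (qmat_mul (qmat_cst q a) y)).
rewrite !qmat_mulA; congr qmat_mul.
by elim/qmatW: x => x; rewrite /qmat_cst !qmatE; apply/qmat_classP/QCstC.
Qed.

HB.instance Definition _ q := GRing.Lalgebra_isAlgebra.Build K (qmat q)
  (@qmat_scaleAr q).

Definition qgen q (k : 'I_2) (i : int) : qmat q := qmat_class q (TGen k i).

Definition qminor q (i j : int) : qmat q :=
  qgen q ord0 i * qgen q ord_max j - q *: (qgen q ord0 j * qgen q ord_max i).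

Lemma qgen_relations q (i j : int) : i < j ->
  [/\ forall k, qgen q k i * qgen q k j = q *: (qgen q k j * qgen q k i),
      qgen q ord0 i * qgen q ord_max i =
        q *: (qgen q ord_max i * qgen q ord0 i),
      qgen q ord0 j * qgen q ord_max i = qgen q ord_max i * qgen q ord0 j &
      qgen q ord0 i * qgen q ord_max j - qgen q ord_max j * qgen q ord0 i =
        (q - q^-1) *: (qgen q ord0 j * qgen q ord_max i)].
Proof.
have mulE x y : qmat_class q x * qmat_class q y = qmat_class q (TMul x y).
  exact: qmat_class_mul.
have addE x y : qmat_class q x + qmat_class q y = qmat_class q (TAdd x y).
  exact: qmat_class_add.
have scaleE a x : a *: qmat_class q x = qmat_class q (TMul (TCst a) x).
  exact: qmat_class_mul.
move=> ij; rewrite /qgen; split=> [k||| ].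
- by rewrite !mulE scaleE; apply/qmat_classP/QRow.
- by rewrite !mulE scaleE; apply/qmat_classP/QCol.
- by rewrite !mulE; apply/qmat_classP/QAnti.
- apply/eqP; rewrite subr_eq addrC; apply/eqP.
  by rewrite !mulE scaleE addE; apply/qmat_classP/QDiag.
Qed.

End QuantumMatrices.

Definition subalg_gen (K : fieldType) (A : algType K) (S : set A) : set A :=
  smallest [set P : set A | GRing.subalg_closed (fun x => x \in P)] S.

Lemma subalg_gen_closed (K : fieldType) (A : algType K) (S : set A) :
  GRing.subalg_closed (fun x => x \in subalg_gen S).
Proof.
split.
- by rewrite inE => P [] [+ _ _] _; rewrite inE.
- move=> a x y; rewrite !inE => Sx Sy P PS; have [[_ lP _] _] := PS.
  by have := lP a x y; rewrite !inE; apply; [exact: Sx | exact: Sy].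
- move=> x y; rewrite !inE => Sx Sy P PS; have [[_ _ mP] _] := PS.
  by have := mP x y; rewrite !inE; apply; [exact: Sx | exact: Sy].
Qed.

Lemma sub_subalg_gen (K : fieldType) (A : algType K) (S : set A) :
  S `<=` subalg_gen S.
Proof. exact: sub_gen_smallest. Qed.

Section QuantumGrassmannian.
Context {K : fieldType}.
Implicit Type q : K.

Definition qgr_set q : set (qmat q) :=
  subalg_gen [set qminor q p.1 p.2 | p in [set p : int * int | p.1 < p.2]].

Record qGr q := QGr { qGr_val : qmat q; _ : qGr_val \in @qgr_set q }.

HB.instance Definition _ q := [isSub for @qGr_val q].
HB.instance Definition _ q := [Choice of qGr q by <:].

Lemma qgr_set_closed q : GRing.subsemialg_closed (fun x => x \in @qgr_set q).
Proof. exact/GRing.subalg_closed_semi/subalg_gen_closed. Qed.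

HB.instance Definition _ q :=
  GRing.SubChoice_isSubAlgebra.Build K (qmat q) _ (qGr q) (@qgr_set_closed q).

(* Only meaningful for i < j; the default value 0 is never used.              *)
Definition qplucker q (i j : int) : qGr q := insubd 0 (qminor q i j).

Lemma val_qplucker q (i j : int) :
  i < j -> val (qplucker q i j) = qminor q i j.
Proof.
by move=> ij; apply: insubdK; rewrite inE; apply: sub_subalg_gen; exists (i, j).
Qed.

End QuantumGrassmannian.

Arguments qgr_set {K} q _.

(* iota exhibits D as the skew-field of right fractions of A. It is unique up *)
(* to isomorphism over A, and exists when A is a right Ore domain.            *)
Record is_skew_field_of_fractions (K : fieldType) (A : algType K)
    (D : unitAlgType K) (iota : {lrmorphism A -> D}) : Prop :=
  IsSkewFieldOfFractions {
    skew_field_unit : forall x : D, x != 0 -> x \is a GRing.unit;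
    skew_field_inj : injective iota;
    skew_field_frac : forall x : D,
      exists a b : A, b != 0 /\ x = iota a * (iota b)^-1 }.

(* In a seed the index type I is an ambient type; the indices proper form a   *)
(* set V and the mutable ones a subset Mu of V, neither of which changes      *)
(* under mutation. The values of cvar, bmat and lmat are relevant only at     *)
(* indices of V, and at columns of Mu for bmat.                               *)
Record seed (D : Type) (I : Type) := Seed {
  cvar : I -> D;
  bmat : I -> I -> int;
  lmat : I -> I -> int }.

Section QuantumSeeds.
Context {K : fieldType} (D : unitAlgType K) {I : choiceType}.
Variables (q s : K) (le : rel I) (V Mu : set I).
Implicit Types (S : seed D I) (a b c u v : I) (e : I -> int).

Definition exponent e : Prop :=
  finite_set [set v | e v != 0] /\ [set v | e v != 0] `<=` V.

Definition exp_support e : seq I :=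
  sort le (enum_fset (fset_set [set v | e v != 0])).

(* The monomial M(e), where s is the fixed square root of q and le is a total *)
(* order on the indices.                                                      *)
Definition qmonomial S e : D :=
  s ^ (\sum_(v <- exp_support e) \sum_(u <- exp_support e | le u v && (u != v))
         e u * e v * lmat S v u)
  *: \prod_(v <- exp_support e) cvar S v ^ e v.

(* x_a, a in V, generate a quantum torus: the Laurent monomials are linearly  *)
(* independent.                                                               *)
Definition generates_quantum_torus S : Prop :=
  forall (n : nat) (e : 'I_n -> I -> int) (k : 'I_n -> K),
    injective e -> (forall i, exponent (e i)) ->
    \sum_(i < n) k i *: qmonomial S (e i) = 0 -> forall i, k i = 0.

Record quantum_seed S : Prop := QuantumSeed {
  seed_comm : forall a b, V a -> V b ->
    cvar S a * cvar S b = q ^ lmat S a b *: (cvar S b * cvar S a);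
  seed_skew : forall a b, V a -> V b -> lmat S a b = - lmat S b a;
  seed_torus : generates_quantum_torus S;
  seed_finite : forall b, Mu b -> finite_set [set a | V a /\ bmat S a b != 0];
  seed_compat : exists2 m : int, 0 < m & forall b a, Mu b -> V a ->
    \sum_(c \in V) bmat S c b * lmat S c a = m * (a == b)%:R }.

Definition exchange_pos S b : I -> int := fun a =>
  (if `[< V a >] && (0 < bmat S a b) then bmat S a b else 0) - (a == b)%:R.

Definition exchange_neg S b : I -> int := fun a =>
  (if `[< V a >] && (bmat S a b < 0) then - bmat S a b else 0) - (a == b)%:R.

Definition mut_cvar S b : I -> D := fun a =>
  if a == b then qmonomial S (exchange_pos S b) + qmonomial S (exchange_neg S b)
  else cvar S a.

Definition mut_bmat S b : I -> I -> int := fun a c =>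
  if (a == b) || (c == b) then - bmat S a c
  else bmat S a c
       + ((`|bmat S a b| * bmat S b c + bmat S a b * `|bmat S b c|) %/ 2)%Z.

Definition mut_lrow S b : I -> int := fun c =>
  - lmat S b c + \sum_(a \in [set a | V a /\ 0 < bmat S a b])
                    bmat S a b * lmat S a c.

Definition mut_lmat S b : I -> I -> int := fun a c =>
  if a == b then (if c == b then 0 else mut_lrow S b c)
  else if c == b then - mut_lrow S b a else lmat S a c.

Definition mutate S b : seed D I :=
  Seed (mut_cvar S b) (mut_bmat S b) (mut_lmat S b).

(* All entries, frozen ones included, of all clusters obtained by finite      *)
(* sequences of mutations at mutable indices.                                 *)
Definition cluster_variables S : set D :=
  [set x | exists2 bs : seq I, (forall b, b \in bs -> Mu b) &
           exists2 a, V a & x = cvar (foldl mutate S bs) a].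

End QuantumSeeds.

Notation chord := (int * int)%type.

Section InfinityGon.
Implicit Types (t : set chord) (a b : chord).

Definition is_arc a : Prop := a.1 <= a.2 - 2.

Definition sides : set chord := [set (n, n + 1) | n in [set: int]].

Definition crossing a b : Prop :=
  (a.1 < b.1 /\ b.1 < a.2 /\ a.2 < b.2) \/
  (b.1 < a.1 /\ a.1 < b.2 /\ b.2 < a.2).

Definition noncrossing_arcs t : Prop :=
  (forall a, t a -> is_arc a) /\ (forall a b, t a -> t b -> ~ crossing a b).

Definition triangulation t : Prop :=
  noncrossing_arcs t /\
  forall t', noncrossing_arcs t' -> t `<=` t' -> t' `<=` t.

Definition locally_finite t : Prop :=
  forall n : int, finite_set [set a | t a /\ (a.1 = n \/ a.2 = n)].

Definition left_fountain t (n : int) : Prop :=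
  infinite_set [set m : int | t (m, n)].

Definition right_fountain t (n : int) : Prop :=
  infinite_set [set p : int | t (n, p)].

Definition fountain t n : Prop := left_fountain t n /\ right_fountain t n.

Definition split_fountain t l r : Prop :=
  [/\ left_fountain t l, right_fountain t r & l <> r].

Definition vertices t : set chord := t `|` sides.

Definition mutable t : set chord :=
  [set a | t a /\ ~ (exists l r, split_fountain t l r /\ a = (l, r))].

Definition frozen t : set chord := vertices t `\` mutable t.

Definition arrows t a b : set (int * int * int) :=
  [set z | let: (i, j, k) := z in
     [/\ i < j, j < k &
         [/\ vertices t (i, j), vertices t (j, k) & vertices t (i, k)]] /\
     [\/ a = (i, j) /\ b = (i, k), a = (i, k) /\ b = (j, k) |
         a = (j, k) /\ b = (i, j)] /\
     ~ (frozen t a /\ frozen t b)].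

Definition num_arrows t a b : nat := #|` fset_set (arrows t a b)|.

Definition exchange_matrix t a b : int :=
  (num_arrows t a b)%:Z - (num_arrows t b a)%:Z.

(* For crossing a and b, which never occur together in a triangulation, the   *)
(* value is irrelevant.                                                       *)
Definition comm_matrix a b : int :=
  let: (i, j) := a in let: (k, l) := b in
  if [|| (i == k) && (k < j) && (j == l), (i < k) && (k < l) && (l < j)
       | (k < i) && (i < j) && (j < l)] then 0
  else if [|| (i < k) && (k < j) && (j == l), (i == k) && (k < j) && (j < l)
            | (i < j) && (j == k) && (k < l)] then 1
  else if [|| (k < i) && (i < j) && (j == l), (i == k) && (k < l) && (l < j)
            | (k < l) && (l == i) && (i < j)] then -1
  else if (i < j) && (j < k) && (k < l) then 2
  else if (k < l) && (l < i) && (i < j) then -2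
  else 0.

(* The total order used to write monomials: lexicographic.                    *)
Definition chord_le a b : bool :=
  (a.1 < b.1) || ((a.1 == b.1) && (a.2 <= b.2)).

End InfinityGon.

Section ClusterStructure.
Context {K : fieldType} (q s : K) (D : unitAlgType K).
Variable iota : {lrmorphism qGr q -> D}.
Implicit Types (t F : set chord).

Definition initial_seed t : seed D chord :=
  Seed (fun a => iota (qplucker q a.1 a.2)) (exchange_matrix t) comm_matrix.

(* The coefficients are the Pluecker coordinates indexed by F.                *)
Definition yields_qca t F (R : set (qGr q)) : Prop :=
  [/\ frozen t = F,
      quantum_seed q s chord_le (vertices t) (mutable t) (initial_seed t) &
      subalg_gen (cluster_variables s chord_le (vertices t) (mutable t)
                                   (initial_seed t))
        = iota @` R].

Definition plucker_subalg (P : int -> int -> Prop) : set (qGr q) :=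
  subalg_gen [set qplucker q p.1 p.2 |
              p in [set p : int * int | p.1 < p.2 /\ P p.1 p.2]].

End ClusterStructure.

Arguments plucker_subalg {K} q P _.

(* Main.v *)
From HB Require Import structures.
Require Import Defs.
From mathcomp Require Import all_boot all_order all_algebra.
From mathcomp Require Import generic_quotient finmap.
From mathcomp Require Import boolp classical_sets functions cardinality fsbigop.
From mathcomp Require Import reals complex.
From mathcomp Require Import zify ring.

Set Implicit Arguments.
Unset Strict Implicit.
Unset Printing Implicit Defensive.

Import Order.TTheory GRing.Theory Num.Theory.
Local Open Scope classical_set_scope.
Local Open Scope ring_scope.

(** The cluster variables obtained from [t] are the Pluecker coordinates of the
  chords obtained from [t] by flips. Showing this takes some noncommutative
  algebra, for the seeds, and the combinatorics of flips, for the chords.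

  Algebra. A generator in column [c] quasi-commutes with the minor [(i, j)]
  when [c] is not strictly between [i] and [j] ([qgen_minor_outside]), and
  satisfies a three-term relation otherwise ([qgen_minor_inside]). The first
  fact gives the quasi-commutation of minors of noncrossing chords
  ([qminor_quasicomm]); both together give the two quantum exchange relations
  of a quadrilateral ([qminor_exchange_13], [qminor_exchange_24]). The mutation
  of the variable of a diagonal is such a relation divided by that variable.

  Independence. To see that the variables of a seed generate a quantum torus,
  let quantum matrices act on functions on a lattice by X_2i = T_i and
  X_1i = sum over k >= i of U_k T_i, where the T_i and U_k are quasi-commuting
  shifts. The minor [(i, j)] then acts as the sum over i <= k < j of
  U_k T_i T_j, whose term k = i is of least weight. The leading term of a
  monomial in minors records how many of its chords begin, and how many end,
  at each integer. A family of noncrossing chords is determined by these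
  numbers, as a sequence of parentheses determines its matching
  ([noncrossing_exponents]); hence monomials in noncrossing minors have
  distinct leading terms ([qminor_monomials_free]).

  Combinatorics. An arc of [t] is the long side of a triangle, and it is a
  short side of another one unless it joins a left-fountain to a right-fountain
  ([triangle_below], [triangle_above]); so an arc can be flipped exactly when
  it is mutable. A flip changes the two matrices of [t] as mutation prescribes
  ([arrow_matrix_flip], [flip_comm_matrix]). Therefore every mutated seed is
  the seed of some triangulation, up to a change of labels
  ([labelled_mutate]). A flip exchanges a single arc, so it keeps the fountains;
  and no chord of a triangulation has a fountain strictly inside. Conversely,
  if no fountain lies strictly inside [(i, j)], then finitely many arcs cross
  [(i, j)], some flip lowers their number ([flip_towards]), and [(i, j)] is
  reached after finitely many flips ([flip_reach_chord]). In each of the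
  three cases the chords [(i, j)] allowed by the theorem are those with no
  fountain strictly inside. *)

(** * Quasi-commutation of quantum minors *)

(** Identities between minors are checked on coordinates: once both sides are
  combinations of the same three normally ordered monomials, it remains to
  compare three coefficients in the field. *)
Section Lin3.
Context {K : fieldType} {V : lmodType K} (u v w : V).

Definition lin3 (a b c : K) : V := a *: u + b *: v + c *: w.

Lemma lin3D a b c a' b' c' :
  lin3 a b c + lin3 a' b' c' = lin3 (a + a') (b + b') (c + c').
Proof. by rewrite /lin3 !scalerDl addrACA (addrACA (a *: u)). Qed.

Lemma lin3Z k a b c : k *: lin3 a b c = lin3 (k * a) (k * b) (k * c).
Proof. by rewrite /lin3 !scalerDr !scalerA. Qed.

Lemma lin3N a b c : - lin3 a b c = lin3 (- a) (- b) (- c).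
Proof. by rewrite /lin3 !opprD !scaleNr. Qed.

Lemma lin3_1 : u = lin3 1 0 0.
Proof. by rewrite /lin3 !scale0r scale1r !addr0. Qed.

Lemma lin3_2 : v = lin3 0 1 0.
Proof. by rewrite /lin3 !scale0r scale1r add0r addr0. Qed.

Lemma lin3_3 : w = lin3 0 0 1.
Proof. by rewrite /lin3 !scale0r scale1r !add0r. Qed.
End Lin3.

Section Minors.
Context {K : fieldType} (q : K).
Hypothesis q0 : q != 0.
Implicit Types (i j k a b c d : int).

Local Notation x := (qgen q ord0).
Local Notation y := (qgen q ord_max).
Local Notation D := (qminor q).

Lemma qgen_xx i j z : i < j -> x i * (x j * z) = q *: (x j * (x i * z)).
Proof. by case/(qgen_relations q) => h _ _ _; rewrite mulrA h -scalerAl mulrA. Qed.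

Lemma qgen_yy i j z : i < j -> y i * (y j * z) = q *: (y j * (y i * z)).
Proof. by case/(qgen_relations q) => h _ _ _; rewrite mulrA h -scalerAl mulrA. Qed.

Lemma qgen_xy i z : x i * (y i * z) = q *: (y i * (x i * z)).
Proof.
have : i < i + 1 by lia.
by case/(qgen_relations q) => _ h _ _; rewrite mulrA h -scalerAl mulrA.
Qed.

Lemma qgen_xy_gt i j z : i < j -> x j * (y i * z) = y i * (x j * z).
Proof. by case/(qgen_relations q) => _ _ h _; rewrite mulrA h mulrA. Qed.

Lemma qgen_xy_lt i j z : i < j ->
  x i * (y j * z) = y j * (x i * z) + (q - q^-1) *: (y i * (x j * z)).
Proof.
case/(qgen_relations q) => _ _ h /eqP; rewrite subr_eq => /eqP h'.
by rewrite mulrA h' addrC h mulrDl -scalerAl !mulrA.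
Qed.

(** The normal form of a minor: [y] before [x], larger columns first. *)
Lemma qminorE i j : i < j -> D i j = y j * x i - q^-1 *: (y i * x j).
Proof.
move=> ij; rewrite /qminor -[y j]mulr1 -[y i]mulr1 (qgen_xy_lt _ ij).
rewrite (qgen_xy_gt _ ij) !mulr1 -addrA -scalerBl -scaleNr; congr (_ + _ *: _).
by ring.
Qed.

Lemma qminorEz i j z : i < j ->
  D i j * z = y j * (x i * z) - q^-1 *: (y i * (x j * z)).
Proof. by move=> ij; rewrite qminorE // mulrBl -scalerAl !mulrA. Qed.

(** The rewriting rules that bring products of generators to normal form. They
  act in front of an arbitrary factor [z], so that they apply anywhere in a
  product associated to the right. *)
Lemma qgen_normal i j (ij : i < j) :
  ((forall z, (x i * (x j * z) = q *: (x j * (x i * z)))%R) *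
   (forall z, (y i * (y j * z) = q *: (y j * (y i * z)))%R) *
   (forall z, (x j * (y i * z) = y i * (x j * z))%R) *
   (forall z, (x i * (y j * z) =
      y j * (x i * z) + (q - q^-1) *: (y i * (x j * z)))%R))%type.
Proof.
by split; [split; [split|]|] => z;
  [exact: qgen_xx | exact: qgen_yy | exact: qgen_xy_gt | exact: qgen_xy_lt].
Qed.

Ltac normal_order r := rewrite ?mulr1 !qminorEz //
  ?(mulrDr, mulrN, scalerDr, scalerN, =^~ scalerAr, r, qgen_xy).

(* The combination is made opaque before rewriting, since the monomials occur
   in its body. *)
Ltac by_coeffs u v w :=
  let e1 := fresh in let e2 := fresh in let e3 := fresh in
  let FD := fresh in let FN := fresh in let FZ := fresh in
  let F := fresh in
  generalize (lin3_1 u v w) (lin3_2 u v w) (lin3_3 u v w)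
    (lin3D u v w) (lin3N u v w) (lin3Z u v w);
  generalize (lin3 u v w);
  move=> F e1 e2 e3 FD FN FZ;
  rewrite ?e1 ?e2 ?e3; clear e1 e2 e3;
  rewrite !(FD, FN, FZ); f_equal; field; exact: q0.

Lemma qgen_minor_lt c i j z : c < i -> i < j ->
  x c * (D i j * z) = q *: (D i j * (x c * z)) /\
  y c * (D i j * z) = q *: (D i j * (y c * z)).
Proof.
move=> ci ij; have cj := lt_trans ci ij; split;
normal_order (qgen_normal ci, qgen_normal cj, qgen_normal ij).
- by_coeffs (y j * (x i * (x c * z))) (y c * (x j * (x i * z)))
            (y i * (x j * (x c * z))).
- by_coeffs (y j * (y c * (x i * z))) (y i * (y c * (x j * z))) (0 : qmat q).
Qed.

Lemma qgen_minor_left i j z : i < j ->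
  x i * (D i j * z) = D i j * (x i * z) /\
  y i * (D i j * z) = D i j * (y i * z).
Proof.
move=> ij; split; normal_order (qgen_normal ij).
- by_coeffs (y j * (x i * (x i * z))) (y i * (x j * (x i * z)))
            (0 : qmat q).
- by_coeffs (y j * (y i * (x i * z))) (y i * (y i * (x j * z)))
            (0 : qmat q).
Qed.

Lemma qgen_minor_right i j z : i < j ->
  x j * (D i j * z) = D i j * (x j * z) /\
  y j * (D i j * z) = D i j * (y j * z).
Proof.
move=> ij; split; normal_order (qgen_normal ij).
- by_coeffs (y j * (x j * (x i * z))) (y i * (x j * (x j * z)))
            (0 : qmat q).
- by_coeffs (y j * (y j * (x i * z))) (y j * (y i * (x j * z)))
            (0 : qmat q).
Qed.

Lemma qgen_minor_gt c i j z : i < j -> j < c ->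
  x c * (D i j * z) = q^-1 *: (D i j * (x c * z)) /\
  y c * (D i j * z) = q^-1 *: (D i j * (y c * z)).
Proof.
move=> ij jc; have ic := lt_trans ij jc; split;
normal_order (qgen_normal jc, qgen_normal ic, qgen_normal ij).
- by_coeffs (y j * (x c * (x i * z))) (y i * (x c * (x j * z)))
            (0 : qmat q).
- by_coeffs (y c * (y j * (x i * z))) (y c * (y i * (x j * z)))
            (y j * (y i * (x c * z))).
Qed.

Lemma qgen_minor_outside (r : 'I_2) c i j z : i < j -> c <= i \/ j <= c ->
  qgen q r c * (D i j * z) =
  q ^ ((c < i)%R%:Z - (j < c)%R%:Z) *: (D i j * (qgen q r c * z)).
Proof.
move=> ij out.
have rE : r = ord0 \/ r = ord_max.
  by case: r => [[|[|//]] ?]; [left | right]; apply: val_inj.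
case: (ltgtP c i) out => [ci _|ic [//|]|-> _].
- rewrite (_ : (j < c) = false) ?subr0; last by lia.
  by case: (qgen_minor_lt z ci ij) => ? ?; case: rE => ->.
- rewrite le_eqVlt => /orP[/eqP <-|jc].
    rewrite ltxx scale1r.
    by case: (qgen_minor_right z ij) => ? ?; case: rE => ->.
  by rewrite jc; case: (qgen_minor_gt z ij jc) => ? ?; case: rE => ->.
- rewrite (_ : (j < i) = false) ?subr0 ?scale1r; last by lia.
  by case: (qgen_minor_left z ij) => ? ?; case: rE => ->.
Qed.

(** For q = 1 this is the vanishing of the determinant with rows r, 1, 2 in the
  columns a, b, c, expanded along its first row. *)
Lemma qgen_minor_inside (r : 'I_2) a b c z : a < b -> b < c ->
  qgen q r b * (D a c * z) =
  q^-1 *: (qgen q r a * (D b c * z)) + q *: (qgen q r c * (D a b * z)).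
Proof.
move=> ab bc; have ac := lt_trans ab bc.
have [->|->] : r = ord0 \/ r = ord_max.
  by case: r => [[|[|//]] ?]; [left | right]; apply: val_inj.
all: normal_order (qgen_normal ab, qgen_normal ac, qgen_normal bc).
- by_coeffs (y c * (x b * (x a * z))) (y a * (x c * (x b * z)))
            (y b * (x c * (x a * z))).
- by_coeffs (y c * (y b * (x a * z))) (y c * (y a * (x b * z)))
            (y b * (y a * (x c * z))).
Qed.

Lemma qminorMz i j z : D i j * z = x i * (y j * z) - q *: (x j * (y i * z)).
Proof. by rewrite /qminor mulrBl -scalerAl !mulrA. Qed.

(** The exponent of [q] when a generator of column [i] is moved across the minor
  [(k, l)]. The quasi-commutation exponent of two minors is the sum of this
  number over the endpoints of one chord, provided that none of them is
  strictly inside the other chord. *)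
Definition side_sign i k l : int := (i < k)%R%:Z - (l < i)%R%:Z.

(** Expand the outer minor and move each generator across the inner one. Of two
  noncrossing chords, one always has both endpoints outside the other. *)
Lemma qminor_quasicomm i j k l z : k < l ->
    i <= k \/ l <= i -> j <= k \/ l <= j ->
  D i j * (D k l * z) =
  q ^ (side_sign i k l + side_sign j k l) *: (D k l * (D i j * z)).
Proof.
move=> kl oi oj; rewrite !(qminorMz i j) !qgen_minor_outside // -!scalerAr.
rewrite !qgen_minor_outside // !scalerA mulrBr scalerBr -scalerAr !scalerA.
rewrite (expfzDr (side_sign i k l) (side_sign j k l) q0) /side_sign.
by congr (_ *: _ - _ *: _); [rewrite mulrC | rewrite -mulrA mulrC].
Qed.

(** Expanding the left factor leaves one generator of an inner column against
  the right factor, where the three-term relation applies; the other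
  generator, of an outer column, only contributes a power of [q]. *)
Lemma qminor_exchange_13 a b c d z : a < b -> b < c -> c < d ->
  D a c * (D b d * z) =
  q^-1 *: (D a b * (D c d * z)) + q *: (D b c * (D a d * z)).
Proof.
move=> ab bc cd; have [ac bd] := (lt_trans ab bc, lt_trans bc cd).
have ad := lt_trans ab bd.
have -> : D b c * (D a d * z) = D a d * (D b c * z).
  have e : side_sign a b c + side_sign d b c = 0 by rewrite /side_sign; lia.
  by rewrite (@qminor_quasicomm a d b c) ?e ?expr0z ?scale1r //; lia.
rewrite (qminorMz a c) (qminorMz a b) (qminorMz a d).
rewrite !(@qgen_minor_outside _ a b d); try lia.
rewrite -?scalerAr !(qgen_minor_inside _ _ bc cd).
rewrite !(@qgen_minor_outside _ a b c); try lia.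
rewrite !(@qgen_minor_outside _ a c d); try lia.
have -> : (a < b) = true by []. have -> : (a < c) = true by [].
have -> : (d < a) = false by lia. have -> : (c < a) = false by lia.
rewrite subr0 expr1z.
rewrite !(mulrDr, scalerDr, scalerN, =^~ scalerAr, scalerA).
rewrite opprD addrACA.
by congr (_ *: _ - _ *: _ + (_ *: _ - _ *: _)); field.
Qed.

Lemma qminor_exchange_24 a b c d z : a < b -> b < c -> c < d ->
  D b d * (D a c * z) =
  q^-1 *: (D a d * (D b c * z)) + q^-1 *: (D a b * (D c d * z)).
Proof.
move=> ab bc cd; have [ac bd] := (lt_trans ab bc, lt_trans bc cd).
have ad := lt_trans ab bd.
have -> : D a b * (D c d * z) = q ^+ 2 *: (D c d * (D a b * z)).
  have e : side_sign a c d + side_sign b c d = 2 by rewrite /side_sign; lia.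
  by rewrite (@qminor_quasicomm a b c d) ?e //; lia.
rewrite (qminorMz b d) (qminorMz a d) (qminorMz c d).
rewrite !(@qgen_minor_outside _ d a c); try lia.
rewrite -?scalerAr !(qgen_minor_inside _ _ ab bc).
rewrite !(@qgen_minor_outside _ d b c); try lia.
rewrite !(@qgen_minor_outside _ d a b); try lia.
have -> : (b < d) = true by [].
have -> : (d < a) = false by lia. have -> : (d < b) = false by lia.
have -> : (c < d) = true by [].
rewrite (_ : false%:Z - true%:Z = -1) // exprN1.
rewrite !(mulrDr, scalerDr, scalerN, =^~ scalerAr, scalerA).
rewrite opprD addrACA.
by congr (_ *: _ - _ *: _ + (_ *: _ - _ *: _)); field.
Qed.
End Minors.

(** * A representation of quantum matrices by shift operators *)

(** The exponents of monomials in the shifts T_i and U_k. The first two components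
  count, for every integer [k], the T_j and the U_l with index above [k]: these
  are the numbers that the quasi-commutation exponents depend on, and keeping
  them as coordinates avoids infinite sums. The other two components are the
  number of the T_j and the sum of the indices of the U_l. *)
Definition shift_lattice : Type := ((int -> int) * (int -> int) * int * int)%type.
HB.instance Definition _ := GRing.Zmodule.on shift_lattice.

Definition count_t (m : shift_lattice) (i : int) : int := m.1.1.1 i.
Definition count_u (m : shift_lattice) (i : int) : int := m.1.1.2 i.
Definition total_t (m : shift_lattice) : int := m.1.2.
Definition weight (m : shift_lattice) : int := m.2.

Lemma count_tB m n i : count_t (m - n) i = count_t m i - count_t n i.
Proof. by []. Qed.
Lemma count_uB m n i : count_u (m - n) i = count_u m i - count_u n i.
Proof. by []. Qed.
Lemma total_tB m n : total_t (m - n) = total_t m - total_t n.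
Proof. by []. Qed.

Definition tvec (i : int) : shift_lattice := (fun k => (k < i)%R%:Z, 0, 1, 0).
Definition uvec (k : int) : shift_lattice := (0, fun l => (l < k)%R%:Z, 0, k).

(** [W] bounds the sums over k: any finite list of indices gives a
  representation, because the relations hold summand by summand, up to an
  exchange of summation indices. *)
Section Model.
Context {K : fieldType} (q : K).
Hypothesis q0 : q != 0.
Variable W : seq int.

Local Notation F := (shift_lattice -> K^o).

Definition qshift (c : shift_lattice -> int) (v : shift_lattice) (phi : F) : F :=
  fun m => q ^ c m *: phi (m - v).

Fact qshift_is_linear c v : linear (qshift c v).
Proof.
move=> a phi psi; apply/funext => m; rewrite /qshift.
by rewrite [LHS]scalerDr [X in X + _]scalerA mulrC -scalerA.
Qed.
HB.instance Definition _ c v :=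
  GRing.isLinear.Build K F F *:%R (qshift c v) (qshift_is_linear c v).

Lemma qshift_comp c d v w phi :
  qshift c v (qshift d w phi) = qshift (fun m => c m + d (m - v)) (v + w) phi.
Proof.
apply/funext => m; rewrite /qshift scalerA -expfzDr //.
by rewrite opprD [- v - w]addrC addrA addrAC.
Qed.

Lemma qshiftZ a c v phi :
  q ^ a *: qshift c v phi = qshift (fun m => a + c m) v phi.
Proof. by apply/funext => m; rewrite /qshift fctE scalerA -expfzDr. Qed.

Lemma qshift_comm a c d v w phi :
    (forall m, c m + d (m - v) = a + (d m + c (m - w))) ->
  qshift c v (qshift d w phi) = q ^ a *: qshift d w (qshift c v phi).
Proof.
move=> h; rewrite !qshift_comp qshiftZ [w + v]addrC.
by congr qshift; apply/funext => m; rewrite h.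
Qed.

Definition opT i : F -> F := qshift (count_t^~ i) (tvec i).
Definition opU k : F -> F :=
  qshift (fun m => 2 * count_u m k - 2 * count_t m k + total_t m) (uvec k).

Lemma opTZ i a phi : opT i (a *: phi) = a *: opT i phi.
Proof. exact: linearZ. Qed.
Lemma opTD i phi psi : opT i (phi + psi) = opT i phi + opT i psi.
Proof. exact: linearD. Qed.
Lemma opT_sum i (P : pred int) (G : int -> F) :
  opT i (\sum_(l <- W | P l) G l) = \sum_(l <- W | P l) opT i (G l).
Proof. exact: linear_sum. Qed.
Lemma opUZ i a phi : opU i (a *: phi) = a *: opU i phi.
Proof. exact: linearZ. Qed.
Lemma opUD i phi psi : opU i (phi + psi) = opU i phi + opU i psi.
Proof. exact: linearD. Qed.
Lemma opU_sum i (P : pred int) (G : int -> F) :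
  opU i (\sum_(l <- W | P l) G l) = \sum_(l <- W | P l) opU i (G l).
Proof. exact: linear_sum. Qed.

Lemma opTT i j phi : i < j -> opT i (opT j phi) = q *: opT j (opT i phi).
Proof.
move=> ij; rewrite -[in RHS](expr1z q); apply: qshift_comm => m.
by rewrite !count_tB /count_t /=; lia.
Qed.

Lemma opUU k l phi : k < l -> opU k (opU l phi) = q ^+ 2 *: opU l (opU k phi).
Proof.
move=> kl; rewrite (exprnP q 2); apply: qshift_comm => m.
by rewrite !count_tB !total_tB !count_uB /count_t /count_u /total_t /=; lia.
Qed.

Lemma opTU_lt k j phi : k < j -> opT j (opU k phi) = q *: opU k (opT j phi).
Proof.
move=> kj; rewrite -[in RHS](expr1z q); apply: qshift_comm => m.
by rewrite !count_tB !total_tB !count_uB /count_t /count_u /total_t /=; lia.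
Qed.

Lemma opTU_ge k j phi :
  j <= k -> opT j (opU k phi) = q^-1 *: opU k (opT j phi).
Proof.
move=> jk; rewrite -(exprN1 q); apply: qshift_comm => m.
by rewrite !count_tB !total_tB !count_uB /count_t /count_u /total_t /=; lia.
Qed.

Definition opX i (phi : F) : F := \sum_(k <- W | i <= k) opU k (opT i phi).

Fact opX_is_linear i : linear (opX i).
Proof.
move=> a phi psi; rewrite /opX scaler_sumr -big_split /=.
by apply: eq_bigr => k _; rewrite opTD opTZ opUD opUZ.
Qed.
Lemma opXXE i j phi : opX i (opX j phi) =
  \sum_(k <- W | i <= k) \sum_(l <- W | j <= l) opU k (opT i (opU l (opT j phi))).
Proof. by apply: eq_bigr => k _; rewrite opT_sum opU_sum. Qed.

(** In the sum over k >= i, the terms with k < j match those of the other side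
  one by one, and the rest is a double sum over the indices >= j in which the
  two indices can be exchanged. *)
Lemma opXX i j phi : i < j -> opX i (opX j phi) = q *: opX j (opX i phi).
Proof.
move=> ij; rewrite !opXXE [in RHS]exchange_big scaler_sumr /=.
rewrite (bigID (fun k => j <= k)) /= [RHS](bigID (fun k => j <= k)) /=.
congr (_ + _); last first.
  apply: eq_bigr => k /andP[ik kj]; rewrite scaler_sumr.
  apply: eq_bigr => l jl; rewrite (@opTU_ge l i); last by lia.
  rewrite (@opTU_lt k j); last by lia.
  rewrite (opTT _ ij) !(opUZ, opTZ) (@opUU k l); last by lia.
  by rewrite !scalerA; congr (_ *: _); field.
rewrite (eq_bigl (fun k => j <= k)) => [|k]; last by lia.
rewrite [RHS](eq_bigl (fun k => j <= k)) => [|k]; last by lia.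
under [RHS]eq_bigr do rewrite scaler_sumr.
rewrite [RHS]exchange_big /=; apply: eq_bigr => k jk; apply: eq_bigr => l jl.
rewrite (@opTU_ge l i) 1?(@opTU_ge l j) //; last by lia.
rewrite (opTT _ ij) !(opUZ, opTZ) !scalerA.
by congr (_ *: _); field.
Qed.

Lemma opXT_same i phi : opX i (opT i phi) = q *: opT i (opX i phi).
Proof.
rewrite /opX opT_sum scaler_sumr; apply: eq_bigr => k ik.
by rewrite opTU_ge // scalerA mulfV // scale1r.
Qed.

Lemma opXT_gt i j phi : i < j -> opX j (opT i phi) = opT i (opX j phi).
Proof.
move=> ij; rewrite /opX opT_sum; apply: eq_bigr => k jk.
rewrite (@opTU_ge k i); last by lia.
by rewrite (opTT _ ij) opUZ scalerA mulVf // scale1r.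
Qed.

Lemma opXT_lt i j phi : i < j ->
  opX i (opT j phi) = opT j (opX i phi) + (q - q^-1) *: opX j (opT i phi).
Proof.
move=> ij; rewrite /opX opT_sum scaler_sumr.
rewrite (bigID (fun k => j <= k)) /= [X in _ = X + _](bigID (fun k => j <= k)).
rewrite /= addrAC; congr (_ + _); last first.
  apply: eq_bigr => k /andP[ik kj]; rewrite (@opTU_lt k j); last by lia.
  by rewrite (opTT _ ij) opUZ.
rewrite (eq_bigl (fun k => j <= k)) => [|k]; last by lia.
rewrite [X in _ = X + _](eq_bigl (fun k => j <= k)) => [|k]; last by lia.
rewrite -big_split; apply: eq_bigr => k jk /=.
rewrite opTU_ge // (opTT _ ij) opUZ -scalerDl.
by congr (_ *: _); ring.
Qed.

Fixpoint eval_term (t : qmat_term K) : F -> F :=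
  match t with
  | TGen r i => if r == ord0 then opX i else opT i
  | TCst a => fun phi => a *: phi
  | TAdd s t => fun phi => eval_term s phi + eval_term t phi
  | TMul s t => fun phi => eval_term s (eval_term t phi)
  end.

Fact eval_term_linear t : linear (eval_term t).
Proof.
elim: t => [r i|b|s IHs t IHt|s IHs t IHt] a phi psi /=.
- by case: ifP => _; [exact: opX_is_linear | exact: qshift_is_linear].
- by rewrite scalerDr !scalerA mulrC.
- by rewrite IHs IHt scalerDr addrACA.
- by rewrite IHt IHs.
Qed.
HB.instance Definition _ t :=
  GRing.isLinear.Build K F F *:%R (eval_term t) (eval_term_linear t).

(** So [eval_term] passes to the quotient [qmat q]. *)
Lemma eval_term_sound s t : qmat_eq q s t -> eval_term s = eval_term t.
Proof.
elim=> {s t} //=.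
- by move=> x y z _ -> _ ->.
- by move=> x x' y y' _ -> _ ->.
- by move=> x x' y y' _ -> _ ->.
- by move=> x y z; apply/funext => phi; rewrite addrA.
- by move=> x y; apply/funext => phi; rewrite addrC.
- by move=> x; apply/funext => phi; rewrite scale0r add0r.
- by move=> x; apply/funext => phi; rewrite scaleN1r addNr scale0r.
- by move=> x; apply/funext => phi; rewrite scale1r.
- by move=> x; apply/funext => phi; rewrite scale1r.
- by move=> x y z; apply/funext => phi; rewrite linearD.
- by move=> a b; apply/funext => phi; rewrite scalerDl.
- by move=> a b; apply/funext => phi; rewrite scalerA.
- by move=> a x; apply/funext => phi; rewrite linearZ.
- move=> k i j ij; apply/funext => phi.
  by case: (k == ord0); [exact: opXX | exact: opTT].
- by move=> i; apply/funext => phi; exact: opXT_same.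
- by move=> i j ij; apply/funext => phi; exact: opXT_gt.
- by move=> i j ij; apply/funext => phi; exact: opXT_lt.
Qed.

Definition qmat_rep (x : qmat q) : F -> F := eval_term (repr x).

Lemma qmat_rep_class t : qmat_rep (qmat_class q t) = eval_term t.
Proof. by apply: eval_term_sound; apply/qmat_classP/qmat_class_repr. Qed.

Lemma qmat_repD x y phi : qmat_rep (x + y) phi = qmat_rep x phi + qmat_rep y phi.
Proof. by rewrite [x + y]/(qmat_add x y) qmat_rep_class. Qed.

Lemma qmat_repM x y phi : qmat_rep (x * y) phi = qmat_rep x (qmat_rep y phi).
Proof. by rewrite [x * y]/(qmat_mul x y) qmat_rep_class. Qed.

Lemma qmat_repZ a x phi : qmat_rep (a *: x) phi = a *: qmat_rep x phi.
Proof.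
rewrite [a *: x]/(qmat_mul (qmat_cst q a) x) [LHS]qmat_repM.
by rewrite /qmat_cst qmat_rep_class.
Qed.

Lemma qmat_rep1 phi : qmat_rep 1 phi = phi.
Proof. by rewrite [1]/(qmat_cst q 1) qmat_rep_class /= scale1r. Qed.

Lemma qmat_rep_sum I (r : seq I) (P : pred I) (G : I -> qmat q) phi :
  qmat_rep (\sum_(i <- r | P i) G i) phi = \sum_(i <- r | P i) qmat_rep (G i) phi.
Proof.
elim/big_rec2: _ => [|i x y _ <-]; last exact: qmat_repD.
by rewrite -[0](scale0r (0 : qmat q)) qmat_repZ scale0r.
Qed.

Lemma qmat_rep_x i : qmat_rep (qgen q ord0 i) = opX i.
Proof. exact: qmat_rep_class. Qed.

Lemma qmat_rep_y i : qmat_rep (qgen q ord_max i) = opT i.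
Proof. exact: qmat_rep_class. Qed.

(** The terms with k >= j of the two products of a minor cancel. *)
Lemma opX_minor i j phi : i < j ->
  opX i (opT j phi) - q *: opX j (opT i phi) =
  \sum_(k <- W | (i <= k) && (k < j)) opU k (opT i (opT j phi)).
Proof.
move=> ij; rewrite /opX. rewrite [X in X - _](bigID (fun k => j <= k)).
rewrite addrAC scaler_sumr (eq_bigl (fun k => j <= k)) => [|k]; last by lia.
rewrite -sumrB big1 => [|k jk].
  by rewrite add0r; apply: eq_bigl => k; rewrite ltNge.
by rewrite (opTT _ ij) opUZ subrr.
Qed.

Lemma qmat_rep_minor i j phi : i < j -> qmat_rep (qminor q i j) phi =
  \sum_(k <- W | (i <= k) && (k < j)) opU k (opT i (opT j phi)).
Proof.
move=> ij; rewrite -opX_minor // /qminor qmat_repD -scaleNr qmat_repZ.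
by rewrite 2!qmat_repM 2!qmat_rep_x 2!qmat_rep_y scaleNr.
Qed.

Definition leading (phi : F) (m : shift_lattice) : Prop := phi m != 0 /\
  forall n, phi n != 0 -> weight m <= weight n /\ (weight n = weight m -> n = m).

Definition chord_vec (v : chord) : shift_lattice := uvec v.1 + tvec v.1 + tvec v.2.

(** Among the terms i <= k < j of the minor, k = i adds the least weight. *)
Lemma leading_minor i j phi m : uniq W -> i \in W -> i < j ->
  leading phi m -> leading (qmat_rep (qminor q i j) phi) (m + chord_vec (i, j)).
Proof.
move=> uW iW ij [m0 lm].
have E n : exists2 c : int -> K, (forall k, c k != 0) &
    qmat_rep (qminor q i j) phi n =
    \sum_(k <- W | (i <= k) && (k < j))
      c k * phi (n - (uvec k + tvec i + tvec j)).
  exists (fun k => q ^ (2 * count_u n k - 2 * count_t n k + total_t n +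
      count_t (n - uvec k) i + count_t (n - (uvec k + tvec i)) j)).
    by move=> k; apply: expfz_neq0.
  rewrite qmat_rep_minor // fct_sumE; apply: eq_bigr => k _.
  by rewrite /opT /opU !qshift_comp.
have wE n k : weight (n - (uvec k + tvec i + tvec j)) = weight n - k.
  by rewrite /weight /= addr0 addr0.
split=> [|n].
  case: (E (m + chord_vec (i, j))) => c c0 ->.
  rewrite big_mkcond (bigD1_seq i) //= lexx ij /=.
  rewrite big1 ?addr0 => [|k ki].
    by rewrite -[uvec i + _ + _]/(chord_vec (i, j)) addrK mulf_neq0.
  case: ifP => // /andP[ik kj].
  apply/eqP; rewrite mulf_eq0 (negPf (c0 k)) /=; apply: contraT => /lm.
  by rewrite wE /weight /= !addr0; lia.
case: (E n) => c c0 -> /eqP s0.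
have [k /and3P[kW /andP[ik kj]]] : exists k, [&& k \in W, (i <= k) && (k < j) &
    phi (n - (uvec k + tvec i + tvec j)) != 0].
  apply: contrapT => h; apply: s0; rewrite big_seq_cond big1 // => k kP.
  apply/eqP; rewrite mulf_eq0 (negPf (c0 k)) /=; apply: contraT => p0.
  by case: h; exists k; case/andP: kP => -> ->.
case/lm; rewrite wE => wk nm.
have wm : weight (m + chord_vec (i, j)) = weight m + i.
  by rewrite /weight /= !addr0.
split; first by rewrite wm; lia.
rewrite wm => wn; have ki : k = i by lia.
by rewrite -nm ?ki ?subrK //; lia.
Qed.

Lemma leading_power v phi m n : uniq W -> v.1 \in W -> v.1 < v.2 ->
  leading phi m ->
  leading (qmat_rep (qminor q v.1 v.2 ^+ n) phi) (m + chord_vec v *+ n).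
Proof.
move=> uW vW v12 lm; elim: n => [|n IH]; first by rewrite qmat_rep1 addr0.
rewrite exprS qmat_repM mulrSr addrA [v]surjective_pairing.
exact: leading_minor IH.
Qed.

Lemma leading_monomial (l : seq chord) (e : chord -> nat) phi m :
    uniq W -> {in l, forall v, v.1 \in W /\ v.1 < v.2} ->
  leading phi m ->
  leading (qmat_rep (\prod_(v <- l) qminor q v.1 v.2 ^+ e v) phi)
          (m + \sum_(v <- l) chord_vec v *+ e v).
Proof.
move=> uW; elim: l => [|v l IH] h lm; first by rewrite !big_nil qmat_rep1 addr0.
rewrite !big_cons qmat_repM [chord_vec v *+ _ + _]addrC addrA.
have [vW v12] := h v (mem_head _ _).
apply: leading_power => //; apply: IH => // w wl; apply: h.
by rewrite inE wl orbT.
Qed.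

End Model.

(** * Linear independence of monomials in noncrossing minors *)

Ltac chord_lia :=
  repeat match goal with
  | v : prod _ _ |- _ => destruct v
  | v : Equality.sort (Datatypes_prod__canonical__eqtype_Equality _ _) |- _ =>
      destruct v
  end; cbn [fst snd] in *; lia.

Lemma sum0_another (I : eqType) (r : seq I) (P : pred I) (h : I -> int) v :
    uniq r -> v \in r -> P v -> h v != 0 -> \sum_(w <- r | P w) h w = 0 ->
  exists w, [/\ w \in r, P w, w != v & h w != 0].
Proof.
move=> ur vr Pv hv; rewrite big_mkcond (bigD1_seq v) //= Pv => s0.
apply: contrapT => no; move: s0; rewrite big_seq_cond big1 ?addr0 => [/eqP|w].
  by rewrite (negPf hv).
case/andP=> wr wv; case: ifP => // Pw; apply/eqP/contraT => hw.
by case: no; exists w.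
Qed.

(** Take a shortest chord [v] with a nonzero coefficient. As the sums at its
  two ends vanish, there are other such chords starting and ending where [v]
  does. Being longer than [v], they cross. *)
Lemma noncrossing_exponents (l : seq chord) (h : chord -> int) : uniq l ->
    {in l &, forall v w, ~ crossing v w} -> {in l, forall v, v.1 < v.2} ->
    (forall a, \sum_(v <- l | v.1 == a) h v = 0) ->
    (forall a, \sum_(v <- l | v.2 == a) h v = 0) ->
  {in l, forall v, h v = 0}.
Proof.
move=> ul nc lt12 h1 h2 v vl.
have [n] := ubnP (absz (v.2 - v.1)); elim: n v vl => // n IH v vl vn.
apply/eqP/contraT => hv.
have [w [wl /eqP w1 wv hw]] := sum0_another ul vl (eqxx v.1) hv (h1 v.1).
have [u [u_l /eqP u2 uv hu]] := sum0_another ul vl (eqxx v.2) hv (h2 v.2).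
have [lv lw lu] := And3 (lt12 v vl) (lt12 w wl) (lt12 u u_l).
have w2 : v.2 < w.2.
  rewrite ltNge; apply: contra hw => wv2; apply/eqP/IH => //.
  have : w.2 != v.2.
    apply: contra wv => /eqP w2.
    by rewrite [w]surjective_pairing w1 w2 -surjective_pairing.
  by move/eqP; chord_lia.
have u1 : u.1 < v.1.
  rewrite ltNge; apply: contra hu => uv1; apply/eqP/IH => //.
  have : u.1 != v.1.
    apply: contra uv => /eqP u1.
    by rewrite [u]surjective_pairing u1 u2 -surjective_pairing.
  by move/eqP; chord_lia.
by case: (nc u w u_l wl); left; chord_lia.
Qed.

Lemma count_chord_vec (l : seq chord) (e : chord -> nat) k :
  (count_u (\sum_(v <- l) chord_vec v *+ e v) k =
     \sum_(v <- l) (e v)%:Z * (k < v.1)%R%:Z) *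
  (count_t (\sum_(v <- l) chord_vec v *+ e v) k =
     \sum_(v <- l) (e v)%:Z * ((k < v.1)%R%:Z + (k < v.2)%R%:Z)).
Proof.
have uM v n : count_u (chord_vec v *+ n) k = n%:Z * (k < v.1)%R%:Z.
  elim: n => [|n IH]; first by rewrite mul0r.
  rewrite mulrS [LHS](_ : _ = (k < v.1)%R%:Z + count_u (chord_vec v *+ n) k).
    by rewrite IH; lia.
  by congr (_ + _); rewrite /count_u /chord_vec /= !fctE /= addr0 addr0.
have tM v n : count_t (chord_vec v *+ n) k = n%:Z * ((k < v.1)%R%:Z + (k < v.2)%R%:Z).
  elim: n => [|n IH]; first by rewrite mul0r.
  rewrite mulrS [LHS](_ : _ = (k < v.1)%R%:Z + (k < v.2)%R%:Z + count_t (chord_vec v *+ n) k).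
    by rewrite IH; lia.
  by congr (_ + _); rewrite /count_t /chord_vec /= !fctE /= add0r.
split; elim: l => [|v l IH]; rewrite ?big_nil // !big_cons -IH.
  by rewrite -uM.
by rewrite -tM.
Qed.

Lemma chord_vec_inj (l : seq chord) (e e' : chord -> nat) : uniq l ->
    {in l &, forall v w, ~ crossing v w} -> {in l, forall v, v.1 < v.2} ->
    \sum_(v <- l) chord_vec v *+ e v = \sum_(v <- l) chord_vec v *+ e' v ->
  {in l, e =1 e'}.
Proof.
move=> ul nc lt12 eqv v vl.
pose h v := (e v)%:Z - (e' v)%:Z.
have hu k : \sum_(v <- l) h v * (k < v.1)%R%:Z = 0.
  under eq_bigr do rewrite mulrBl.
  by rewrite sumrB -!(count_chord_vec _ _ _).1 eqv subrr.
have hut k : \sum_(v <- l) h v * ((k < v.1)%R%:Z + (k < v.2)%R%:Z) = 0.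
  under eq_bigr do rewrite mulrBl.
  by rewrite sumrB -!(count_chord_vec _ _ _).2 eqv subrr.
have ht k : \sum_(v <- l) h v * (k < v.2)%R%:Z = 0.
  rewrite -[RHS](subrr 0) -[X in _ = X - _](hut k) -[X in _ = _ - X](hu k).
  by rewrite -sumrB; apply: eq_bigr => w _; rewrite mulrDr addrC addrA addNr add0r.
suff /(_ v vl) : {in l, forall v, h v = 0} by rewrite /h; lia.
apply: noncrossing_exponents => // a.
- rewrite -[RHS](subrr 0) -[X in _ = X - _](hu (a - 1)) -[X in _ = _ - X](hu a).
  rewrite -sumrB big_mkcond; apply: eq_bigr => w _.
  by case: eqP; chord_lia.
- rewrite -[RHS](subrr 0) -[X in _ = X - _](ht (a - 1)) -[X in _ = _ - X](ht a).
  rewrite -sumrB big_mkcond; apply: eq_bigr => w _.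
  by case: eqP; chord_lia.
Qed.

(** Act on the delta function at 0. Among the monomials that occur, choose one
  whose leading point [m] has least weight: the other ones vanish at [m], since
  their leading points differ from [m]. *)
Lemma qminor_monomials_free (K : fieldType) (q : K) (l : seq chord)
    (n : nat) (e : 'I_n -> chord -> nat) (k : 'I_n -> K) : q != 0 ->
    uniq l -> {in l &, forall v w, ~ crossing v w} ->
    {in l, forall v, v.1 < v.2} ->
    (forall i j, {in l, e i =1 e j} -> i = j) ->
    \sum_(i < n) k i *: \prod_(v <- l) qminor q v.1 v.2 ^+ e i v = 0 ->
  forall i, k i = 0.
Proof.
move=> q0 ul nc lt12 inj_e sum0 i0.
apply/eqP/contraT => ki0.
pose W := undup (map fst l).
pose delta : shift_lattice -> K^o := fun m => `[< m = 0 >]%:R.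
pose mon i := \prod_(v <- l) qminor q v.1 v.2 ^+ e i v.
pose lead i := \sum_(v <- l) chord_vec v *+ e i v.
have lead0 : leading delta 0.
  split=> [|m]; rewrite /delta; first by rewrite asboolT // oner_eq0.
  by case: asboolP => [-> //|]; rewrite eqxx.
have leadE i : leading (qmat_rep W (mon i) delta) (lead i).
  rewrite -[lead i]add0r; apply: leading_monomial => //.
    exact: undup_uniq.
  by move=> v vl; split; [rewrite mem_undup; apply: map_f | exact: lt12].
case: (arg_minP (fun i => weight (lead i)) (P := fun i => k i != 0) ki0).
move=> i ki imin.
have /(congr1 (fun x => qmat_rep W x delta (lead i))) := sum0.
have repE j : qmat_rep W (k j *: mon j) delta (lead i) =
    k j * qmat_rep W (mon j) delta (lead i) by rewrite qmat_repZ.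
have rep0 : qmat_rep W (0 : qmat q) delta = 0.
  by rewrite -(scale0r (0 : qmat q)) qmat_repZ // scale0r.
rewrite rep0 qmat_rep_sum // fct_sumE (bigD1 i) //= [X in _ + X]big1 ?addr0 => [|j ji].
  move/eqP; rewrite repE mulf_eq0 (negPf ki) /=.
  by case: (leadE i) => /negPf ->.
rewrite repE; apply/eqP; rewrite mulf_eq0.
case: eqP => //= /eqP kj; apply: contraT => /(proj2 (leadE j)) [wle weq].
case/eqP: ji; apply: inj_e => v vl; apply/esym.
apply: (chord_vec_inj ul nc lt12) => //; apply: weq; apply/eqP.
by rewrite eq_le wle imin.
Qed.

(** * Triangles in a triangulation *)

Lemma int_max_below (P : int -> Prop) (a b : int) : a < b -> P a ->
  exists m : int, [/\ a <= m, m < b, P m & forall k, m < k -> k < b -> ~ P k].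
Proof.
have [n] := ubnP (absz (b - a)); elim: n a => // n IH a ban ab Pa.
have [[c [ac cb Pc]]|no] := pselect (exists c : int, [/\ a < c, c < b & P c]).
  have [|m [cm mb Pm maxm]] := IH c _ cb Pc; first by lia.
  by exists m; split=> //; lia.
by exists a; split=> // k ak kb Pk; apply: no; exists k.
Qed.

Lemma seq_int_bounded (s : seq int) :
  exists b : int, forall x, x \in s -> - b <= x /\ x <= b.
Proof.
elim: s => [|y s [b hb]]; first by exists 0.
exists (`|y| + `|b|) => x; rewrite inE => /predU1P[->|/hb]; lia.
Qed.

Lemma unbounded_below_infinite (A : set int) : 
  (forall n : int, exists2 m, A m & m < n) -> infinite_set A.
Proof.
move=> h /finite_seqP[s As]; have [b hb] := seq_int_bounded s.
have [m] := h (- b); rewrite As => /= /hb; lia.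
Qed.

Lemma unbounded_above_infinite (A : set int) :
  (forall n : int, exists2 m, A m & n < m) -> infinite_set A.
Proof.
move=> h /finite_seqP[s As]; have [b hb] := seq_int_bounded s.
have [m] := h b; rewrite As => /= /hb; lia.
Qed.

Lemma infinite_unbounded_above (A : set int) (n : int) : infinite_set A ->
  (forall m, A m -> n < m) -> forall b : int, exists2 m, A m & b < m.
Proof.
move=> infA lbA b; apply: contrapT => no; apply: infA.
pose s := [seq n + k%:Z | k <- iota 0 (absz (b - n)).+1].
apply: (@sub_finite_set _ _ [set` s]); last exact: finite_seq.
move=> m Am; have nm := lbA m Am; have mb : m <= b.
  by rewrite leNgt; apply/negP => bm; apply: no; exists m.
suff : m \in s by []; apply/mapP.
by exists (absz (m - n)); [rewrite mem_iota; lia | lia].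
Qed.

Lemma infinite_unbounded_below (A : set int) (n : int) : infinite_set A ->
  (forall m, A m -> m < n) -> forall b : int, exists2 m, A m & m < b.
Proof.
move=> infA lbA b; apply: contrapT => no; apply: infA.
pose s := [seq n - k%:Z | k <- iota 0 (absz (b - n)).+1].
apply: (@sub_finite_set _ _ [set` s]); last exact: finite_seq.
move=> m Am; have nm := lbA m Am; have mb : b <= m.
  by rewrite leNgt; apply/negP => bm; apply: no; exists m.
suff : m \in s by []; apply/mapP.
by exists (absz (m - n)); [rewrite mem_iota; lia | lia].
Qed.

Section Triangulation.
Variables (t : set chord).
Hypothesis tT : triangulation t.
Implicit Types i j k l m p : int.
Local Notation V i j := (vertices t (i, j)).

Lemma arc_len i j : t (i, j) -> i <= j - 2.
Proof. by case: tT => -[h _] _ /h. Qed.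

Lemma vertex_side i : V i (i + 1).
Proof. by right; exists i. Qed.

Lemma vertexP i j : V i j -> j = i + 1 \/ t (i, j) /\ i <= j - 2.
Proof.
case=> [tij|[n _ [<- <-]]]; last by left.
by right; split=> //; exact: arc_len.
Qed.

Lemma vertex_lt i j : V i j -> i < j.
Proof. by move/vertexP; lia. Qed.

Lemma vertex_nc i j k l : V i j -> V k l -> i < k -> k < j -> j < l -> False.
Proof.
move=> /vertexP[|[tij _]]; first by lia.
move=> /vertexP[|[tkl _]]; first by lia.
by move=> ik kj jl; case: tT => -[_ /(_ _ _ tij tkl) nc] _; apply: nc; left.
Qed.

(** Maximality of the triangulation, for sides and arcs alike. *)
Lemma vertex_max i j : i < j ->
  (forall k l, V k l -> i < k -> k < j -> j < l -> False) ->
  (forall k l, V k l -> k < i -> i < l -> l < j -> False) -> V i j.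
Proof.
move=> ij h1 h2; have [->|jni] := eqVneq j (i + 1); first exact: vertex_side.
left; case: tT => -[ta nc] tmax.
apply: (tmax (t `|` [set (i, j)])); [split | by left | by right].
  by move=> a [/ta //|->]; rewrite /is_arc /=; lia.
have nij k l : t (k, l) -> ~ crossing (i, j) (k, l).
  move=> tkl; have Vkl : V k l by left.
  by case=> /= [[a [b c]]|[a [b c]]]; [exact: h1 Vkl a b c | exact: h2 Vkl a b c].
move=> [a1 a2] [b1 b2] [ta1|[-> ->]] [tb1|[-> ->]].
- exact: nc.
- by move=> ab; apply: (nij _ _ ta1); rewrite /crossing /= in ab *; lia.
- exact: nij.
- by rewrite /crossing /=; lia.
Qed.

(** The apex is the last neighbour of [i] before [j]. *)
Lemma triangle_below i j : V i j -> i <= j - 2 ->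
  exists m, [/\ i < m, m < j, V i m & V m j].
Proof.
move=> Vij ij.
have [||m [im mj Vim maxm]] := @int_max_below (fun m => V i m) (i + 1) j.
- by lia.
- exact: vertex_side.
exists m; split=> //; first by lia.
apply: vertex_max => // k l Vkl mk kl lm.
  have ki : i < k by lia.
  exact: vertex_nc Vij Vkl ki kl lm.
have [ki|ki|ki] := ltgtP k i; last by subst k; exact: maxm l kl lm Vkl.
  have il : i < l by lia.
  exact: vertex_nc Vkl Vij ki il lm.
exact: vertex_nc Vim Vkl ki mk kl.
Qed.

Definition strictly_contained i j a b :=
  [/\ V a b, a <= i, j <= b & a < i \/ j < b].

(** If no chord of [t] contains [(i, j)], then for each chord [(m, i)] of [t] the
  chord [(m, j)] is not in [t]; what crosses it can only be some [(m', i)] with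
  m' < m. Starting from the side at [i], this gives infinitely many arcs. *)
Lemma contained_or_left_fountain i j : V i j ->
  (exists a b, strictly_contained i j a b) \/ left_fountain t i.
Proof.
move=> Vij; have [|no] := pselect (exists a b, strictly_contained i j a b).
  by left.
have ij := vertex_lt Vij; right.
have no' a b : V a b -> a <= i -> j <= b -> a < i \/ j < b -> False.
  by move=> Vab ai jb s; apply: no; exists a, b.
have step m : V m i -> exists m', V m' i /\ m' < m.
  move=> Vmi; have mi := vertex_lt Vmi; apply: contrapT => nostep.
  apply: (no' m j) => //; [|by lia|by left].
  apply: vertex_max => [|k l Vkl mk kj jl|k l Vkl km ml lj]; first by lia.
    have [ik|ki] := ltP i k; first exact: vertex_nc Vij Vkl ik kj jl.
    by apply: (no' k l) => //; [lia | right].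
  have [il|li|li] := ltgtP i l.
  - have ki : k < i by lia.
    exact: vertex_nc Vkl Vij ki il lj.
  - exact: vertex_nc Vkl Vmi km ml li.
  - by apply: nostep; exists k; rewrite li.
apply: unbounded_below_infinite => // n.
have [k] := ubnP (absz (i - n)); elim: k n => // k IH n nk.
have [m [Vm mn]] : exists m, V m i /\ m < n; last first.
  have [m' [Vm' mm']] := step _ Vm.
  exists m'; last by lia.
  by case/vertexP: Vm' => [|[//]]; have := vertex_lt Vm; lia.
have [ni|ni] := leP i n.
  exists (i - 1); split; last by lia.
  by have := vertex_side (i - 1); rewrite subrK.
have [|m tm mn] := IH (n + 1); first by lia.
have Vm : V m i by left.
by have [m' [Vm' m'm]] := step _ Vm; exists m'; split=> //; lia.
Qed.

Lemma contained_or_right_fountain i j : V i j ->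
  (exists a b, strictly_contained i j a b) \/ right_fountain t j.
Proof.
move=> Vij; have [|no] := pselect (exists a b, strictly_contained i j a b).
  by left.
have ij := vertex_lt Vij; right.
have no' a b : V a b -> a <= i -> j <= b -> a < i \/ j < b -> False.
  by move=> Vab ai jb s; apply: no; exists a, b.
have step m : V j m -> exists m', V j m' /\ m < m'.
  move=> Vjm; have jm := vertex_lt Vjm; apply: contrapT => nostep.
  apply: (no' i m) => //; [|by lia|by right].
  apply: vertex_max => [|k l Vkl ik km ml|k l Vkl ki il lm]; first by lia.
    have [jk|kj|kj] := ltgtP j k.
    - exact: vertex_nc Vjm Vkl jk km ml.
    - have jl : j < l by lia.
      exact: vertex_nc Vij Vkl ik kj jl.
    - by apply: nostep; exists l; rewrite kj.
  have [lj|jl] := ltP l j; first exact: vertex_nc Vkl Vij ki il lj.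
  by apply: (no' k l) => //; [lia | left].
apply: unbounded_above_infinite => // n.
have [k] := ubnP (absz (n - j)); elim: k n => // k IH n nk.
have [m [Vm mn]] : exists m, V j m /\ n < m; last first.
  have [m' [Vm' mm']] := step _ Vm.
  exists m'; last by lia.
  by case/vertexP: Vm' => [|[//]]; have := vertex_lt Vm; lia.
have [ni|ni] := leP n j.
  by exists (j + 1); split; [exact: vertex_side | lia].
have [|m tm mn] := IH (n - 1); first by lia.
have Vm : V j m by left.
by have [m' [Vm' m'm]] := step _ Vm; exists m'; split=> //; lia.
Qed.

(** The triangle below a shortest chord containing [(i, j)] has [(i, j)] as a
  side. *)
Lemma triangle_above i j : V i j ->
    ~ (left_fountain t i /\ right_fountain t j) ->
  (exists p, [/\ j < p, V i p & V j p]) \/ (exists p, [/\ p < i, V p i & V p j]).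
Proof.
move=> Vij nf; have ij := vertex_lt Vij.
have [a [b abij]] : exists a b, strictly_contained i j a b.
  case: (contained_or_left_fountain Vij) => // lf.
  by case: (contained_or_right_fountain Vij) => // rf; case: nf.
have [n] := ubnP (absz (b - a)); elim: n a b abij => // n IH a b [Vab ai jb s] ban.
have [|m [am mb Vam Vmb]] := triangle_below Vab; first by lia.
have [jm|mj] := leP j m.
  have [s'|/not_orP[ai' jm']] := pselect (a < i \/ j < m).
    by apply: (IH a m); [split | lia].
  have [? ?] : a = i /\ m = j by lia.
  by subst a m; left; exists b.
have [mi|im] := leP m i.
  have [s'|/not_orP[mi' jb']] := pselect (m < i \/ j < b).
    by apply: (IH m b); [split | lia].
  have [? ?] : m = i /\ b = j by lia.
  by subst m b; right; exists a.
have [a_i|i_a] := ltP a i; first by case: (vertex_nc Vam Vij).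
have [? jb'] : a = i /\ j < b by lia.
by subst a; case: (vertex_nc Vij Vmb).
Qed.
End Triangulation.

(** * Arrows of the exchange quiver and quadrilaterals *)

(** [x], [y], [z] are the edges of a triangle, in the cyclic order of the
  arrows x -> y -> z -> x. *)
Definition triangle3 (x y z : chord) : Prop := exists i j k : int,
  [/\ i < j, j < k &
     [\/ [/\ x = (i, j), y = (i, k) & z = (j, k)],
         [/\ x = (i, k), y = (j, k) & z = (i, j)] |
         [/\ x = (j, k), y = (i, j) & z = (i, k)]]].

Definition arrow t (x y : chord) : Prop := exists z,
  [/\ triangle3 x y z, vertices t x, vertices t y & vertices t z].

Lemma triangle3_rot x y z : triangle3 x y z -> triangle3 y z x.
Proof.
case=> i [j [k [ij jk h]]]; exists i, j, k; split=> //.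
by case: h => [[-> -> ->]|[-> -> ->]|[-> -> ->]];
  [constructor 2 | constructor 3 | constructor 1].
Qed.

Lemma triangle3_fun x y z z' : triangle3 x y z -> triangle3 x y z' -> z = z'.
Proof.
case=> i [j [k [ij jk [[-> -> ->]|[-> -> ->]|[-> -> ->]]]]];
by case=> i' [j' [k' [ij' jk' [[[? ?] [? ?] ->]|[[? ?] [? ?] ->]|
  [[? ?] [? ?] ->]]]]]; subst; f_equal; lia.
Qed.

(** Two edges determine their triangle, so that there is at most one arrow, and
  no arrow at a mutable arc is discarded. *)
Lemma num_arrowsE t a b : mutable t a \/ mutable t b ->
  num_arrows t a b = `[< arrow t a b >].
Proof.
move=> mut; have nf : ~ (frozen t a /\ frozen t b).
  by case=> -[_ fa] [_ fb]; case: mut.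
rewrite /num_arrows; case: asboolP => [[z [[i [j [k [ij jk h]]]] Va Vb Vz]]|no].
  suff -> : arrows t a b = [set (i, j, k)] by rewrite fset_set1 cardfs1.
  apply/seteqP; split=> [[[i' j'] k'] [[ij' jk' _] [h' _]]|[[i' j'] k'] [-> -> ->]].
    by case: h => [[? ? ?]|[? ? ?]|[? ? ?]]; subst a b z;
    case: h' => [[[? ?] [? ?]]|[[? ?] [? ?]]|[[? ?] [? ?]]]; subst=> /=;
    repeat f_equal; lia.
  split; last by split=> //; case: h => [[-> -> _]|[-> -> _]|[-> -> _]];
    [constructor 1 | constructor 2 | constructor 3].
  by split=> //; case: h => [[? ? ?]|[? ? ?]|[? ? ?]]; subst a b z.
suff -> : arrows t a b = set0 by rewrite fset_set0 cardfs0.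
apply/seteqP; split=> // -[[i j] k] [[ij jk [V1 V2 V3]] [h _]]; case: no.
by case: h => -[-> ->]; [exists (j, k) | exists (i, j) | exists (i, k)];
  split=> //; exists i, j, k; split=> //;
  [constructor 1 | constructor 2 | constructor 3].
Qed.

(** The exchange matrix before discarding the arrows between frozen vertices. *)
Definition arrow_matrix t (x y : chord) : int :=
  `[< arrow t x y >]%:Z - `[< arrow t y x >]%:Z.

Lemma exchange_matrixE t a b : mutable t b ->
  exchange_matrix t a b = arrow_matrix t a b.
Proof. by move=> mb; rewrite /exchange_matrix !num_arrowsE; tauto. Qed.

Lemma crossing_sym x y : crossing x y -> crossing y x.
Proof. by case; [right | left]. Qed.

Ltac by_crossing tT := exfalso; first
  [ lia
  | match goal with
    | H1 : vertices _ (?i, ?j), H2 : vertices _ (?k, ?l) |- False =>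
        solve [apply: (vertex_nc tT H1 H2); lia]
    end ].

Section Flip.
Variables (t : set chord).
Hypothesis tT : triangulation t.
Implicit Types i j k l m p a b c d : int.
Local Notation V i j := (vertices t (i, j)).

Lemma vertices_nc x y : vertices t x -> vertices t y -> ~ crossing x y.
Proof.
case: x y => [i j] [k l] Vx Vy [] /= [h1 [h2 h3]].
  exact: vertex_nc Vx Vy h1 h2 h3.
exact: vertex_nc Vy Vx h1 h2 h3.
Qed.

Lemma left_fountain_uniq k l : left_fountain t k -> left_fountain t l -> k = l.
Proof.
wlog kl : k l / k < l => [hw fk fl|fk fl].
  by case: (ltgtP k l) => // kl; [exact: hw | apply/esym; exact: hw].
have lt_arc a b : t (a, b) -> a < b by move/(arc_len tT); lia.
have [m tm mk] := infinite_unbounded_below fl (fun m => @lt_arc m l) k.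
have [p tp pm] := infinite_unbounded_below fk (fun m => @lt_arc m k) m.
by case: (vertex_nc tT (or_introl tp) (or_introl tm)).
Qed.

Lemma right_fountain_uniq k l :
  right_fountain t k -> right_fountain t l -> k = l.
Proof.
wlog kl : k l / k < l => [hw fk fl|fk fl].
  by case: (ltgtP k l) => // kl; [exact: hw | apply/esym; exact: hw].
have lt_arc a b : t (a, b) -> a < b by move/(arc_len tT); lia.
have [m tm mk] := infinite_unbounded_above fk (fun m => @lt_arc k m) l.
have [p tp pm] := infinite_unbounded_above fl (fun m => @lt_arc l m) m.
by case: (vertex_nc tT (or_introl tm) (or_introl tp)).
Qed.

(** An arc ending at the fountain and starting far away crosses every chord
  around the fountain. *)
Lemma left_fountain_arc l i j : left_fountain t l -> V i j -> j <= l \/ l <= i.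
Proof.
move=> fl Vij; have [|lj] := leP j l; first by left.
have [|il] := leP l i; first by right.
have lt_arc a b : t (a, b) -> a < b by move/(arc_len tT); lia.
have [m tm mi] := infinite_unbounded_below fl (fun m => @lt_arc m l) i.
by case: (vertex_nc tT (or_introl tm) Vij).
Qed.

Lemma right_fountain_arc l i j :
  right_fountain t l -> V i j -> j <= l \/ l <= i.
Proof.
move=> fl Vij; have [|lj] := leP j l; first by left.
have [|il] := leP l i; first by right.
have lt_arc a b : t (a, b) -> a < b by move/(arc_len tT); lia.
have [m tm mi] := infinite_unbounded_above fl (fun m => @lt_arc l m) j.
by case: (vertex_nc tT Vij (or_introl tm)).
Qed.

Lemma left_right_fountain l r : left_fountain t l -> right_fountain t r -> l <= r.
Proof.
move=> fl fr; have lt_arc a b : t (a, b) -> a < b by move/(arc_len tT); lia.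
rewrite leNgt; apply/negP => rl.
have [m tm mr] := infinite_unbounded_below fl (fun m => @lt_arc m l) r.
by case: (right_fountain_arc fr (or_introl tm)); lia.
Qed.

(** The endpoints of an arc differ, so an arc from a left-fountain to a
  right-fountain always belongs to a split fountain. *)
Lemma mutableP i j : mutable t (i, j) <->
  t (i, j) /\ ~ (left_fountain t i /\ right_fountain t j).
Proof.
split=> -[tij h]; split=> //.
  move=> [fi fj]; apply: h; exists i, j; split=> //; split=> //.
  by have := arc_len tT tij; lia.
by case=> l [r [[fl fr _] [? ?]]]; subst; apply: h.
Qed.

(** The diagonal [o] of a quadrilateral of [t] can be exchanged for [n]. The
  edges are listed so that the two triangles on [o] are m1 -> p1 -> o -> m1 and
  m2 -> p2 -> o -> m2; in this way the two positions of the diagonal can be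
  treated together. *)
Inductive is_flip : chord -> chord -> chord -> chord -> chord -> chord -> Prop :=
| Flip13 a b c d : a < b -> b < c -> c < d ->
    V a b -> V b c -> V c d -> V a d -> V a c ->
    is_flip (a, c) (b, d) (a, b) (b, c) (c, d) (a, d)
| Flip24 a b c d : a < b -> b < c -> c < d ->
    V a b -> V b c -> V c d -> V a d -> V b d ->
    is_flip (b, d) (a, c) (a, d) (a, b) (b, c) (c, d).

Lemma flip_exists i j : mutable t (i, j) ->
  exists (n p1 m1 p2 m2 : chord), is_flip (i, j) n p1 m1 p2 m2.
Proof.
case/mutableP=> tij nf; have Vij : V i j by left.
have [m [im mj Vim Vmj]] := triangle_below tT Vij (arc_len tT tij).
case: (triangle_above tT Vij nf) => -[p].
  by case=> jp Vip Vjp; do 5 eexists; apply: (@Flip13 i m j p).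
by case=> pi Vpi Vpj; do 5 eexists; apply: (@Flip24 p i m j).
Qed.

(** A third triangle on [o] would cross an edge of the quadrilateral. *)
Lemma flip_triangles (o n p1 m1 p2 m2 x y : chord) : is_flip o n p1 m1 p2 m2 ->
    vertices t x -> vertices t y -> triangle3 x y o ->
  (x = m1 /\ y = p1) \/ (x = m2 /\ y = p2).
Proof.
case=> a b c d ab bc cd Vab Vbc Vcd Vad Vo Vx Vy;
case=> i [j [k [ij jk [[? ? [? ?]]|[? ? [? ?]]|[? ? [? ?]]]]]]; subst x y;
subst.
- by_crossing tT.
- right; case: (ltgtP k d) => [kd|dk|-> //]; by_crossing tT.
- left; case: (ltgtP j b) => [kd|dk|-> //]; by_crossing tT.
- left; case: (ltgtP i a) => [kd|dk|-> //]; by_crossing tT.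
- by_crossing tT.
- right; case: (ltgtP j c) => [kd|dk|-> //]; by_crossing tT.
Qed.

End Flip.

(** * Flips of triangulations *)

Definition flip (t : set chord) (o n : chord) : set chord :=
  (t `\ o) `|` [set n].

Lemma quad_crossing (a b c d k l : int) : a < b -> b < c -> c < d ->
    ~ crossing (a, b) (k, l) -> ~ crossing (b, c) (k, l) ->
    ~ crossing (c, d) (k, l) -> ~ crossing (a, d) (k, l) ->
  (crossing (a, c) (k, l) -> k = b /\ l = d) /\
  (crossing (b, d) (k, l) -> k = a /\ l = c).
Proof. by rewrite /crossing /=; split; lia. Qed.

Section FlipTriangulation.
Variables (t : set chord) (o n p1 m1 p2 m2 : chord).
Hypothesis tT : triangulation t.
Hypothesis fT : is_flip t o n p1 m1 p2 m2.
Local Notation V := (vertices t).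
Local Notation t' := (flip t o n).

Lemma flip_old : t o.
Proof.
by case: fT => a b c d ab bc cd _ _ _ _; case/(vertexP tT) => [|[] //]; lia.
Qed.

Lemma flip_new_arc : is_arc n.
Proof. by case: fT => a b c d ab bc cd *; rewrite /is_arc /=; lia. Qed.

Lemma flip_edges : [/\ V p1, V m1, V p2 & V m2].
Proof. by case: fT. Qed.

Lemma flip_crossing : crossing o n.
Proof. by case: fT => a b c d ab bc cd *; rewrite /crossing /=; lia. Qed.

Lemma flip_new_notin : ~ V n.
Proof.
by move=> Vn; apply: (vertices_nc tT _ Vn flip_crossing); left; exact: flip_old.
Qed.

Lemma flip_uniq : uniq [:: o; p1; m1; p2; m2].
Proof.
case: fT => a b c d ab bc cd *; rewrite /= !inE !negb_or !xpair_eqE; lia.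
Qed.

Lemma flip_crossing_old x : V x -> crossing x n -> x = o.
Proof.
case: x => k l Vx; have nc := vertices_nc tT _ Vx.
case: fT => a b c d ab bc cd Vab Vbc Vcd Vad _ /crossing_sym xn;
have [h1 h2] := quad_crossing ab bc cd (nc _ Vab) (nc _ Vbc) (nc _ Vcd) (nc _ Vad).
  by have [-> ->] := h2 xn.
by have [-> ->] := h1 xn.
Qed.

Lemma flip_crossing_new (x : chord) :
    (forall y, t y -> y <> o -> ~ crossing x y) -> is_arc x ->
  crossing x o -> x = n.
Proof.
case: x => k l h xA.
have nc y : V y -> y <> o -> ~ crossing y (k, l).
  move=> [ty|[i _ <-]] yo; first by move/crossing_sym; exact: h.
  by rewrite /crossing /=; lia.
have := flip_uniq; rewrite /= !inE !negb_or => /andP[/and4P[/eqP o1 /eqP o2 /eqP o3 /eqP o4] _].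
have [V1 V2 V3 V4] := flip_edges; move=> /crossing_sym.
case: fT (nc _ V1 (nesym o1)) (nc _ V2 (nesym o2)) (nc _ V3 (nesym o3))
 (nc _ V4 (nesym o4)) => a b c d ab bc cd _ _ _ _ _ n1 n2 n3 n4 xo.
  by have [/(_ xo)[-> ->]] := quad_crossing ab bc cd n1 n2 n3 n4.
by have [_ /(_ xo)[-> ->]] := quad_crossing ab bc cd n2 n3 n4 n1.
Qed.

(** A chord that crosses no edge of the quadrilateral crosses a diagonal only if
  it is the other diagonal; so [n] crosses nothing but [o] in [t], and a chord
  that can be added after the flip is [n] or was in [t] already. *)
Lemma flip_triangulation : triangulation t'.
Proof.
have [[ta nc] tmax] := tT.
have nnc x : t x -> x <> o -> ~ crossing x n.
  by move=> tx xo xn; apply: xo; apply: flip_crossing_old xn; left.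
split; first split.
- by move=> a [[/ta //]|->]; exact: flip_new_arc.
- move=> x y [[tx xo]|->] [[ty yo]|->].
  + exact: nc.
  + exact: nnc.
  + by move/crossing_sym; exact: nnc.
  + by rewrite /crossing; lia.
move=> s [sa snc] ts x sx.
have [->|/eqP xn] := eqVneq x n; first by right.
have nx y : t y -> y <> o -> ~ crossing x y.
  by move=> ty yo; apply: snc => //; apply: ts; left.
have nxo : ~ crossing x o.
  by move=> xo; apply: xn; apply: flip_crossing_new => //; exact: sa.
left; split.
  apply: (tmax (t `|` [set x])); [split | by left | by right].
    by move=> a [/ta //|->]; exact: sa.
  have nx' y : t y -> ~ crossing x y.
    by move=> ty; have [->|/eqP yo] := eqVneq y o; last exact: nx.
  move=> y z [ty|->] [tz|->].
  + exact: nc.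
  + by move/crossing_sym; exact: nx'.
  + exact: nx'.
  + by rewrite /crossing; lia.
move=> /= xo; have : crossing x n by rewrite xo; exact: flip_crossing.
by apply: snc => //; apply: ts; right.
Qed.

Lemma vertices_flip x : vertices t' x <-> (V x /\ x <> o) \/ x = n.
Proof.
split=> [[[[tx xo]|->]|sx]|[[[tx|sx] xo]|->]].
- by left; split=> //; left.
- by right.
- left; split; first by right.
  move=> xo; have := flip_old; rewrite -xo.
  by case: sx => k _ <- /(arc_len tT); lia.
- by left; left.
- by right.
- by left; right.
Qed.

Lemma vertices_flip_old x : V x -> x <> o -> vertices t' x.
Proof. by move=> Vx xo; apply/vertices_flip; left. Qed.

Lemma vertices_flip_new : vertices t' n.
Proof. by apply/vertices_flip; right. Qed.

(** In the opposite flip the roles of the four edges are shifted cyclically by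
  one place, in a direction that depends on the position of the diagonal. *)
Lemma flip_sym : is_flip t' n o m2 p1 m1 p2 \/ is_flip t' n o m1 p2 m2 p1.
Proof.
have [[V1 V2 V3 V4] U] := (flip_edges, flip_uniq).
move: U; rewrite /= !inE !negb_or => /andP[/and4P[/eqP o1 /eqP o2 /eqP o3 /eqP o4] _].
have V1' := vertices_flip_old V1 (nesym o1).
have V2' := vertices_flip_old V2 (nesym o2).
have V3' := vertices_flip_old V3 (nesym o3).
have V4' := vertices_flip_old V4 (nesym o4).
have Vn := vertices_flip_new.
case: fT V1' V2' V3' V4' Vn => a b c d ab bc cd *.
  by left; exact: Flip24.
by right; exact: Flip13.
Qed.

Lemma flip_left_fountain k : left_fountain t' k <-> left_fountain t k.
Proof.
split=> inf fin; apply: inf.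
  apply: (@sub_finite_set _ _ ([set m | t (m, k)] `|` [set n.1])).
    by move=> m /= [[tm _]|<-]; [left | right].
  by rewrite finite_setU; split.
apply: (@sub_finite_set _ _ ([set m | t' (m, k)] `|` [set o.1])).
  move=> m /= tm; have [<-|/eqP mo] := eqVneq (m, k) o; first by right.
  by left; left.
by rewrite finite_setU; split.
Qed.

Lemma flip_right_fountain k : right_fountain t' k <-> right_fountain t k.
Proof.
split=> inf fin; apply: inf.
  apply: (@sub_finite_set _ _ ([set m | t (k, m)] `|` [set n.2])).
    by move=> m /= [[tm _]|<-]; [left | right].
  by rewrite finite_setU; split.
apply: (@sub_finite_set _ _ ([set m | t' (k, m)] `|` [set o.2])).
  move=> m /= tm; have [<-|/eqP mo] := eqVneq (k, m) o; first by right.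
  by left; left.
by rewrite finite_setU; split.
Qed.

Lemma flip_new_triangles x y : vertices t' x -> vertices t' y ->
  triangle3 x y n -> (x = p1 /\ y = m2) \/ (x = p2 /\ y = m1).
Proof.
move=> Vx Vy h; case: flip_sym => f.
  exact: (flip_triangles flip_triangulation f Vx Vy h).
by apply/or_comm; exact: (flip_triangles flip_triangulation f Vx Vy h).
Qed.

Lemma flip_triangle3 : [/\ triangle3 m1 p1 o, triangle3 m2 p2 o,
  triangle3 p1 m2 n & triangle3 p2 m1 n].
Proof.
case: fT => a b c d ab bc cd _ _ _ _ _;
  have [ac bd] : a < c /\ b < d by lia.
- split; [exists a, b, c | exists a, c, d | exists a, b, d | exists b, c, d];
  by split=> //; try (by constructor 1); try (by constructor 2); constructor 3.
- split; [exists a, b, d | exists b, c, d | exists a, c, d | exists a, b, c];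
  by split=> //; try (by constructor 1); try (by constructor 2); constructor 3.
Qed.

Lemma arrow_to_old x : arrow t x o <-> x = p1 \/ x = p2.
Proof.
have [V1 V2 V3 V4] := flip_edges; have Vo : V o by left; exact: flip_old.
have [t1 t2 _ _] := flip_triangle3; split.
  case=> z [/triangle3_rot/triangle3_rot h Vx _ Vz].
  by case: (flip_triangles tT fT Vz Vx h) => -[_ ->]; [left | right].
by case=> ->; [exists m1 | exists m2]; split=> //; exact: triangle3_rot.
Qed.

Lemma arrow_from_old x : arrow t o x <-> x = m1 \/ x = m2.
Proof.
have [V1 V2 V3 V4] := flip_edges; have Vo : V o by left; exact: flip_old.
have [t1 t2 _ _] := flip_triangle3; split.
  case=> z [/triangle3_rot h _ Vx Vz].
  by case: (flip_triangles tT fT Vx Vz h) => -[-> _]; [left | right].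
by case=> ->; [exists p1 | exists p2]; split=> //; do 2 apply: triangle3_rot.
Qed.

(** The flip destroys the two triangles on [o] and creates the two on [n]. *)
Lemma arrow_flip x y : V x -> V y -> x <> o -> y <> o ->
  arrow t' x y <->
  (arrow t x y /\ ~ (x = m1 /\ y = p1 \/ x = m2 /\ y = p2)) \/
  (x = p1 /\ y = m2 \/ x = p2 /\ y = m1).
Proof.
move=> Vx Vy xo yo; have [t1 t2 t3 t4] := flip_triangle3.
have Vx' := vertices_flip_old Vx xo; have Vy' := vertices_flip_old Vy yo.
split=> [[z [h _ _ /vertices_flip[[Vz zo]|zn]]]|[[[z [h _ _ Vz]] no]|new]].
- left; split; first by exists z.
  by case=> -[? ?]; subst x y; apply: zo;
    [apply: triangle3_fun h t1 | apply: triangle3_fun h t2].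
- by right; apply: flip_new_triangles => //; rewrite -zn.
- exists z; split=> //; apply: vertices_flip_old Vz _ => zo.
  by apply: no; apply: (flip_triangles tT fT Vx Vy); rewrite -zo.
- exists n; split=> //; last exact: vertices_flip_new.
  by case: new => -[-> ->].
Qed.

Lemma arrow_new_notin x y : x = p1 /\ y = m2 \/ x = p2 /\ y = m1 ->
  ~ arrow t x y.
Proof.
have [_ _ t3 t4] := flip_triangle3 => new [z [h _ _ Vz]].
by apply: flip_new_notin; case: new => -[? ?]; subst x y;
  [rewrite (triangle3_fun t3 h) | rewrite (triangle3_fun t4 h)].
Qed.

End FlipTriangulation.

(** * Exchange and commutation matrices under a flip *)

Lemma comm_matrix_outside (i j k l : int) : i < j -> k < l ->
    i <= k \/ l <= i -> j <= k \/ l <= j ->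
  comm_matrix (i, j) (k, l) = side_sign i k l + side_sign j k l.
Proof.
rewrite /comm_matrix /side_sign => ij kl oi oj; rewrite ij kl.
by case: (ltgtP i k) oi => ik oi; case: (ltgtP i l) oi => il oi;
  case: (ltgtP j k) oj => jk oj; case: (ltgtP j l) oj => jl oj;
  rewrite //=; exfalso; lia.
Qed.

Lemma comm_matrix_skew (i j k l : int) : i < j -> k < l ->
  comm_matrix (i, j) (k, l) = - comm_matrix (k, l) (i, j).
Proof.
rewrite /comm_matrix => ij kl; rewrite ij kl.
by case: (ltgtP i k) => ik; case: (ltgtP i l) => il;
  case: (ltgtP j k) => jk; case: (ltgtP j l) => jl;
  rewrite //=; exfalso; lia.
Qed.

Lemma comm_matrix_outside_r (i j k l : int) : i < j -> k < l ->
    k <= i \/ j <= k -> l <= i \/ j <= l ->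
  comm_matrix (i, j) (k, l) = - (side_sign k i j + side_sign l i j).
Proof. by move=> ij kl ok ol; rewrite comm_matrix_skew // comm_matrix_outside. Qed.

Section Quad.
Variables a b c d k l : int.
Hypotheses (ab : a < b) (bc : b < c) (cd : c < d) (kl : k < l).
Hypotheses (n1 : ~ crossing (a, b) (k, l)) (n2 : ~ crossing (b, c) (k, l)).
Hypotheses (n3 : ~ crossing (c, d) (k, l)) (n4 : ~ crossing (a, d) (k, l)).
Let ac := lt_trans ab bc.
Let bd := lt_trans bc cd.
Let ad := lt_trans ab bd.

(** If [(k, l)] is not a diagonal, then it has no corner of the quadrilateral
  strictly inside, or none of its endpoints is strictly inside [(a, d)]. In both
  cases its commutation exponents with all edges and diagonals are sums of
  [side_sign], on the left or on the right. *)
Lemma quad_position :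
  [\/ [/\ a <= k \/ l <= a, b <= k \/ l <= b, c <= k \/ l <= c & d <= k \/ l <= d],
      (k <= a \/ d <= k) /\ (l <= a \/ d <= l),
      k = a /\ l = c | k = b /\ l = d].
Proof.
have h1 : a < k -> k < b -> b < l -> False by move=> *; apply: n1; left.
have h1' : k < a -> a < l -> l < b -> False by move=> *; apply: n1; right.
have h2 : b < k -> k < c -> c < l -> False by move=> *; apply: n2; left.
have h2' : k < b -> b < l -> l < c -> False by move=> *; apply: n2; right.
have h3 : c < k -> k < d -> d < l -> False by move=> *; apply: n3; left.
have h3' : k < c -> c < l -> l < d -> False by move=> *; apply: n3; right.
have h4 : a < k -> k < d -> d < l -> False by move=> *; apply: n4; left.
have h4' : k < a -> a < l -> l < d -> False by move=> *; apply: n4; right.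
have [ak|ka] := leP a k; last first.
  have [la|al] := leP l a; first by constructor 1; split; lia.
  by constructor 2; lia.
have [dk|kd] := leP d k; first by constructor 2; lia.
have [bk|kb] := leP b k.
  have ak' : a < k by lia.
  have ld : l <= d by lia.
  have [ck|kc] := leP c k; first by constructor 1; split; lia.
  have [lc|cl] := leP l c; first by constructor 1; split; lia.
  have [dl|ld'] := leP d l; last by lia.
  have [b_k|kb] := ltP b k; first by lia.
  by constructor 4; lia.
have [lb|bl] := leP l b; first by constructor 1; split; lia.
have [a_k|ka] := ltP a k; first by lia.
have [dl|l_d] := leP d l; first by constructor 2; lia.
by constructor 3; lia.
Qed.

(** For a point outside [(a, d)] the exponents of opposite edges, and of the two
  diagonals, have the same sum. *)
Lemma side_sign_quad v : v <= a \/ d <= v ->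
  side_sign v a b + side_sign v c d = side_sign v b c + side_sign v a d /\
  side_sign v a c + side_sign v b d = side_sign v a b + side_sign v c d.
Proof. by rewrite /side_sign; lia. Qed.

Lemma comm_matrix_13 : ~ crossing (a, c) (k, l) ->
  comm_matrix (a, b) (k, l) + comm_matrix (c, d) (k, l)
    - comm_matrix (b, c) (k, l) - comm_matrix (a, d) (k, l)
  = 2 * ((k, l) == (a, c))%:Z /\
  ((k, l) != (a, c) -> comm_matrix (b, d) (k, l) =
    - comm_matrix (a, c) (k, l) + comm_matrix (a, b) (k, l) + comm_matrix (c, d) (k, l)).
Proof.
move=> n5; case: quad_position => [[oa ob oc od]|[ok ol]|[ka lc]|[kb ld]].
- have -> : (k, l) == (a, c) = false.
    by apply/eqP => -[? ?]; subst; lia.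
  by rewrite !comm_matrix_outside //; split; lia.
- have -> : (k, l) == (a, c) = false.
    by apply/eqP => -[? ?]; subst; lia.
  rewrite !comm_matrix_outside_r //; try lia.
  by have [? ?] := side_sign_quad ok; have [? ?] := side_sign_quad ol; split; lia.
- subst k l; rewrite eqxx; split=> //.
  rewrite [comm_matrix (a, d) _]comm_matrix_outside; try lia.
  by rewrite !comm_matrix_outside_r /side_sign; lia.
- by exfalso; subst k l; apply: n5; left => /=; lia.
Qed.

Lemma comm_matrix_24 : ~ crossing (b, d) (k, l) ->
  comm_matrix (a, d) (k, l) + comm_matrix (b, c) (k, l)
    - comm_matrix (a, b) (k, l) - comm_matrix (c, d) (k, l)
  = 2 * ((k, l) == (b, d))%:Z /\
  ((k, l) != (b, d) -> comm_matrix (a, c) (k, l) =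
    - comm_matrix (b, d) (k, l) + comm_matrix (a, d) (k, l) + comm_matrix (b, c) (k, l)).
Proof.
move=> n5; case: quad_position => [[oa ob oc od]|[ok ol]|[ka lc]|[kb ld]].
- have -> : (k, l) == (b, d) = false.
    by apply/eqP => -[? ?]; subst; lia.
  by rewrite !comm_matrix_outside //; split; lia.
- have -> : (k, l) == (b, d) = false.
    by apply/eqP => -[? ?]; subst; lia.
  rewrite !comm_matrix_outside_r //; try lia.
  by have [? ?] := side_sign_quad ok; have [? ?] := side_sign_quad ol; split; lia.
- by exfalso; subst k l; apply: n5; right => /=; lia.
- subst k l; rewrite eqxx; split=> //.
  rewrite [comm_matrix (a, d) _]comm_matrix_outside; try lia.
  by rewrite !comm_matrix_outside_r /side_sign; lia.
Qed.
End Quad.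

Section FlipMatrices.
Variables (t : set chord) (o n p1 m1 p2 m2 : chord).
Hypothesis tT : triangulation t.
Hypothesis fT : is_flip t o n p1 m1 p2 m2.
Local Notation V := (vertices t).
Local Notation t' := (flip t o n).

(** The first equality is the compatibility of the exchange matrix with the
  commutation matrix; the second one is the mutation rule of the commutation
  matrix. *)
Lemma flip_comm_matrix x : V x ->
  comm_matrix p1 x + comm_matrix p2 x - comm_matrix m1 x - comm_matrix m2 x
    = 2 * (x == o)%:Z /\
  (x <> o -> comm_matrix n x =
    - comm_matrix o x + comm_matrix p1 x + comm_matrix p2 x).
Proof.
case: x => k l Vx; have kl := vertex_lt tT Vx.
have nc y (Vy : V y) := vertices_nc tT Vy Vx.
case: fT => a b c d ab bc cd /nc n1 /nc n2 /nc n3 /nc n4 /nc n5.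
  by have [-> h] := comm_matrix_13 ab bc cd kl n1 n2 n3 n4 n5; split=> // /eqP.
by have [-> h] := comm_matrix_24 ab bc cd kl n1 n2 n3 n4 n5; split=> // /eqP.
Qed.

Lemma arrow_matrix_skew x y : arrow_matrix t x y = - arrow_matrix t y x.
Proof. by rewrite /arrow_matrix opprB. Qed.

Lemma arrow_matrix_old x : arrow_matrix t x o =
  (x \in [:: p1; p2])%:Z - (x \in [:: m1; m2])%:Z.
Proof.
rewrite /arrow_matrix; congr (_%:Z - _%:Z); congr nat_of_bool.
  rewrite !inE; apply/asboolP/orP => [/(arrow_to_old tT fT)[->|->]|]; rewrite ?eqxx; auto.
  by move=> h; apply/(arrow_to_old tT fT); case: h => /eqP ->; auto.
rewrite !inE; apply/asboolP/orP => [/(arrow_from_old tT fT)[->|->]|]; rewrite ?eqxx; auto.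
by move=> h; apply/(arrow_from_old tT fT); case: h => /eqP ->; auto.
Qed.

End FlipMatrices.

Section FlipMutation.
Variables (t : set chord) (o n p1 m1 p2 m2 : chord).
Hypothesis tT : triangulation t.
Hypothesis fT : is_flip t o n p1 m1 p2 m2.
Local Notation V := (vertices t).
Local Notation t' := (flip t o n).

Lemma arrow_matrix_new x : arrow_matrix t' x n = - arrow_matrix t x o.
Proof.
have tT' := flip_triangulation tT fT.
rewrite (arrow_matrix_old tT fT) !inE opprB.
by case: (flip_sym tT fT) => f; rewrite (arrow_matrix_old tT' f) !inE;
  rewrite [(x == p1) || _]orbC // [(x == m2) || _]orbC.
Qed.

(** The paths of length two through [o] go from [p1] or [p2] to [m1] or [m2]. Two
  of the four cancel the arrows m1 -> p1 and m2 -> p2 of the old triangles, and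
  the other two are the arrows p1 -> m2 and p2 -> m1 of the new ones. *)
Lemma arrow_matrix_flip x y : V x -> V y -> x <> o -> y <> o ->
  arrow_matrix t' x y = arrow_matrix t x y +
    ((`|arrow_matrix t x o| * arrow_matrix t o y +
      arrow_matrix t x o * `|arrow_matrix t o y|) %/ 2)%Z.
Proof.
move=> Vx Vy xo yo.
rewrite [arrow_matrix t o y]arrow_matrix_skew !(arrow_matrix_old tT fT) !inE.
pose E1 u v := (u == m1) && (v == p1) || (u == m2) && (v == p2).
pose E2 u v := (u == p1) && (v == m2) || (u == p2) && (v == m1).
have E1P u v : reflect (u = m1 /\ v = p1 \/ u = m2 /\ v = p2) (E1 u v).
  apply: (iffP orP) => [[/andP[/eqP-> /eqP->]|/andP[/eqP-> /eqP->]]|]; auto.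
  by case=> -[-> ->]; rewrite !eqxx; auto.
have E2P u v : reflect (u = p1 /\ v = m2 \/ u = p2 /\ v = m1) (E2 u v).
  apply: (iffP orP) => [[/andP[/eqP-> /eqP->]|/andP[/eqP-> /eqP->]]|]; auto.
  by case=> -[-> ->]; rewrite !eqxx; auto.
have step u v : V u -> V v -> u <> o -> v <> o ->
    `[< arrow t' u v >]%:Z = `[< arrow t u v >]%:Z - (E1 u v)%:Z + (E2 u v)%:Z.
  move=> Vu Vv uo vo; have := arrow_flip tT fT Vu Vv uo vo.
  have := @arrow_new_notin _ _ _ _ _ _ _ tT fT u v.
  have : u = m1 /\ v = p1 \/ u = m2 /\ v = p2 -> arrow t u v.
    have [V1 V2 V3 V4] := flip_edges fT; have [t1 t2 _ _] := flip_triangle3 fT.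
    have Vo : V o by left; exact: flip_old fT.
    by case=> -[-> ->]; exists o; split.
  case: (E1P u v) => e1; case: (E2P u v) => e2 a1 a2 a3;
  case: (asboolP (arrow t u v)) => au; case: (asboolP (arrow t' u v)) => au' //=;
  tauto.
have := flip_uniq fT; rewrite /= !inE !negb_or => /and4P[_ /and3P[u1 u2 u3]].
move=> /andP[u4 u5] /andP[u6 _].
have excl u : ((u == p1) + (u == m1) + (u == p2) + (u == m2) <= 1)%N.
  have [->|_] := eqVneq u p1; first by rewrite (negPf u1) (negPf u2) (negPf u3).
  have [->|_] := eqVneq u m1; first by rewrite (negPf u4) (negPf u5).
  by have [->|_] := eqVneq u p2; [rewrite (negPf u6) | case: (u == m2)].
rewrite /arrow_matrix !step // /E1 /E2.
move: (excl x) (excl y) `[< arrow t x y >] `[< arrow t y x >].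
case: (x == p1); case: (x == m1); case: (x == p2); case: (x == m2) => //= _;
case: (y == p1); case: (y == m1); case: (y == p2); case: (y == m2) => //= _;
by case; case.
Qed.

End FlipMutation.

(** * Reaching a chord by flips *)

Section Reach.
Implicit Types (i j m p : int).

Definition crossed_by t i j : set chord := [set x | t x /\ crossing (i, j) x].

Definition inside_nonfountain t i j : Prop := forall k : int,
  i < k -> k < j -> ~ left_fountain t k /\ ~ right_fountain t k.

(** An arc crossing [(i, j)] has an endpoint strictly inside, and each of these
  finitely many integers is an endpoint of finitely many arcs. *)
Lemma crossed_by_finite t i j :
  inside_nonfountain t i j -> finite_set (crossed_by t i j).
Proof.
move=> nf.
pose ends k : set chord := (fun p => (k, p)) @` [set p | t (k, p)] `|`
  (fun m => (m, k)) @` [set m | t (m, k)].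
pose inner := [set k : int | i < k /\ k < j].
apply: (@sub_finite_set _ _ (\bigcup_(k in inner) ends k)).
  move=> [a b] [tab] [] /= [h1 [h2 h3]].
    by exists a; [split | left; exists b].
  by exists b; [split | right; exists a].
apply: bigcup_finite => [|k [ik kj]].
  pose s := [seq i + k%:Z | k <- iota 0 (absz (j - i))].
  apply: (@sub_finite_set _ _ [set` s]); last exact: finite_seq.
  move=> k [ik kj]; suff : k \in s by []; apply/mapP.
  by exists (absz (k - i)); [rewrite mem_iota; lia | lia].
have [lk rk] := nf k ik kj.
by rewrite finite_setU; split; apply: finite_image; apply: contrapT.
Qed.

(** The triangles on the old diagonal are the two halves of the quadrilateral, so
  their apexes are the two other corners. *)
Lemma flip_apex t (u v w : int) (n p1 m1 p2 m2 : chord) : triangulation t ->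
    is_flip t (u, v) n p1 m1 p2 m2 ->
    [/\ w < u, vertices t (w, u) & vertices t (w, v)] \/
    [/\ u < w, w < v, vertices t (u, w) & vertices t (w, v)] ->
  n.1 = w \/ n.2 = w.
Proof.
move=> tT fl h.
inversion fl as [a b c d ab bc cd Vab Vbc Vcd Vad Vo|
                 a b c d ab bc cd Vab Vbc Vcd Vad Vo]; subst.
- case: h => [[wu Vwu Vwv]|[uw wv Vuw Vwv]]; first by by_crossing tT.
  by left; case: (ltgtP b w) => //= ?; by_crossing tT.
- case: h => [[wu Vwu Vwv]|[uw wv Vuw Vwv]].
    by left; case: (ltgtP a w) => //= ?; by_crossing tT.
  by right; case: (ltgtP c w) => //= ?; by_crossing tT.
Qed.

(** Let [m] be the last neighbour of [i] before [j]. The triangle above [(i, m)]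
  has apex beyond [j] or before [i], so its side opposite to [i] crosses
  [(i, j)]. Flipping that side gives a chord ending at [i], which does not
  cross [(i, j)]. *)
Lemma flip_towards t i j : triangulation t -> i < j -> ~ vertices t (i, j) ->
    inside_nonfountain t i j ->
  exists o n p1 m1 p2 m2 : chord, [/\ is_flip t o n p1 m1 p2 m2, mutable t o,
    crossing (i, j) o & ~ crossing (i, j) n].
Proof.
move=> tT ij nVij nf.
have ij2 : i + 1 < j.
  have : j <> i + 1 by move=> ji; apply: nVij; rewrite ji; exact: vertex_side.
  by lia.
have [m [im mj Vim maxm]] :=
  int_max_below (P := fun m => vertices t (i, m)) ij2 (vertex_side t i).
have im' : i < m by lia.
have nf_im : ~ (left_fountain t i /\ right_fountain t m).
  by case: (nf m im' mj) => ? ? [].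
have mut a b : t (a, b) -> i < a /\ a < j \/ i < b /\ b < j -> mutable t (a, b).
  move=> tab h; apply/(mutableP tT); split=> // -[fa fb].
  by case: h => -[h1 h2]; case: (nf _ h1 h2).
have nc (x : chord) : x.1 = i \/ x.2 = i -> ~ crossing (i, j) x.
  by case: x => a b; rewrite /crossing /=; lia.
case: (triangle_above tT Vim nf_im) => -[p].
  case=> mp Vip Vmp.
  have jp : j < p.
    have [//|pj|pj] := ltgtP j p; last by case: nVij; rewrite pj.
    by case: (maxm p mp pj).
  have tmp : t (m, p) by case: (vertexP tT Vmp) => [|[]//]; lia.
  have mmp : mutable t (m, p) by apply: mut => //; lia.
  have [n [p1 [m1 [p2 [m2 fl]]]]] := flip_exists tT mmp.
  exists (m, p), n, p1, m1, p2, m2; split=> //; first by left => /=; lia.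
  by apply: nc; apply: flip_apex tT fl _; left.
case=> pi Vpi Vpm.
have tpm : t (p, m) by case: (vertexP tT Vpm) => [|[]//]; lia.
have mpm : mutable t (p, m) by apply: mut => //; lia.
have [n [p1 [m1 [p2 [m2 fl]]]]] := flip_exists tT mpm.
exists (p, m), n, p1, m1, p2, m2; split=> //; first by right => /=; lia.
by apply: nc; apply: flip_apex tT fl _; right.
Qed.

Inductive flip_reach (t : set chord) : set chord -> Prop :=
| ReachRefl : flip_reach t t
| ReachStep t' (o n p1 m1 p2 m2 : chord) : flip_reach t t' ->
    is_flip t' o n p1 m1 p2 m2 -> mutable t' o -> flip_reach t (flip t' o n).

Lemma flip_reach_first t (o n p1 m1 p2 m2 : chord) s : is_flip t o n p1 m1 p2 m2 ->
  mutable t o -> flip_reach (flip t o n) s -> flip_reach t s.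
Proof.
move=> fl mo; elim=> [|t' o' n' q1 l1 q2 l2 _ IH fl' mo'].
  by apply: ReachStep fl mo; constructor.
exact: ReachStep IH fl' mo'.
Qed.

(** Induction on a finite set containing the arcs that cross [(i, j)]. *)
Lemma flip_reach_chord t i j : triangulation t -> i < j ->
    inside_nonfountain t i j ->
  exists s, flip_reach t s /\ vertices s (i, j).
Proof.
move=> tT ij nf.
have /finite_seqP[s Es] := crossed_by_finite nf.
have {Es} : crossed_by t i j `<=` [set` s] by rewrite Es.
have [k] := ubnP (size s); elim: k t s tT nf => // k IH t s tT nf sk Cs.
have [Vij|nVij] := pselect (vertices t (i, j)); first by exists t; split=> //; constructor.
have [o [n [p1 [m1 [p2 [m2 [fl mo co ncn]]]]]]] := flip_towards tT ij nVij nf.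
have os : o \in s by apply: Cs; split=> //; case: mo.
have [||||u [tu Vu]] := IH (flip t o n) (filter (predC1 o) s).
- exact: flip_triangulation fl.
- move=> m im mj; have [lm rm] := nf m im mj.
  by split=> [/flip_left_fountain|/flip_right_fountain].
- have : (0 < count (pred1 o) s)%N by rewrite -has_count has_pred1.
  have := count_predC (pred1 o) s; rewrite size_filter.
  rewrite (eq_count (a1 := predC1 o) (a2 := predC (pred1 o))) //.
  by move: sk; lia.
- move=> x [[[tx xo]|->] cx] //; rewrite /= mem_filter /= (introN eqP xo).
  by apply: Cs.
by exists u; split=> //; exact: flip_reach_first fl mo tu.
Qed.
End Reach.

(** * Monomials in quasi-commuting variables *)

Section QuasiCommutation.
Context {K : fieldType} {A : unitAlgType K}.
Implicit Types (c d : K) (x y z : A).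

Definition qcomm c x y : Prop := x * y = c *: (y * x).

Lemma qcomm_sym c x y : c != 0 -> qcomm c x y -> qcomm c^-1 y x.
Proof. by move=> c0; rewrite /qcomm => ->; rewrite scalerA mulVf // scale1r. Qed.

Lemma qcomm1 x : qcomm 1 x 1.
Proof. by rewrite /qcomm mulr1 mul1r scale1r. Qed.

Lemma qcommM c d x y z : qcomm c x y -> qcomm d x z -> qcomm (c * d) x (y * z).
Proof.
move=> xy xz; rewrite /qcomm mulrA xy -scalerAl -[y * x * z]mulrA xz -scalerAr.
by rewrite scalerA mulrA.
Qed.

Lemma qcommX c x y n : qcomm c x y -> qcomm (c ^+ n) x (y ^+ n).
Proof.
move=> xy; elim: n => [|n IH]; first exact: qcomm1.
by rewrite !exprS; exact: qcommM.
Qed.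

Lemma qcommV c x y : c != 0 -> y \is a GRing.unit ->
  qcomm c x y -> qcomm c^-1 x y^-1.
Proof.
move=> c0 yU xy; apply: (mulrI yU); rewrite -scalerAr 2!mulrA mulrV // mul1r.
apply: (mulIr yU); rewrite -scalerAl mulrVK //.
by rewrite xy scalerA mulVf // scale1r.
Qed.

Lemma qcomm_exprz_r c x y (n : int) : c != 0 -> y \is a GRing.unit ->
  qcomm c x y -> qcomm (c ^ n) x (y ^ n).
Proof.
move=> c0 yU xy; case: n => n; first exact: qcommX.
by rewrite !NegzE -!exprnN; apply: qcommV; rewrite ?unitrX ?expf_neq0 //; exact: qcommX.
Qed.

Lemma qcomm_exprz c x y (m n : int) : c != 0 -> x \is a GRing.unit ->
    y \is a GRing.unit ->
  qcomm c x y -> qcomm (c ^ (m * n)) (x ^ m) (y ^ n).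
Proof.
move=> c0 xU yU xy; rewrite -exprz_exp; apply: qcomm_exprz_r => //.
  exact: expfz_neq0.
have -> : c ^ m = (c^-1 ^ m)^-1 by rewrite exprz_inv invr_expz opprK.
apply: qcomm_sym.
  by rewrite expfz_neq0 // invr_eq0.
by apply: qcomm_exprz_r => //; [rewrite invr_eq0 | exact: qcomm_sym].
Qed.

Lemma qcomm_prod_l (I : eqType) (r : seq I) (F : I -> A) y :
    (forall i, i \in r -> exists2 c, c != 0 & qcomm c (F i) y) ->
  exists2 c, c != 0 & qcomm c (\prod_(i <- r) F i) y.
Proof.
elim: r => [|i r IH] h.
  by exists 1; rewrite ?oner_eq0 // big_nil /qcomm mulr1 mul1r scale1r.
have [c c0 iy] := h i (mem_head i r).
have [j jr|d d0 ry] := IH; first by apply: h; rewrite inE jr orbT.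
exists (d * c); first exact: mulf_neq0.
rewrite big_cons /qcomm -[LHS]mulrA ry -scalerAr [F i * (y * _)]mulrA iy.
by rewrite -scalerAl scalerA -[y * _ * _]mulrA.
Qed.

Lemma qcomm_prod_mul (I : eqType) (r : seq I) (F G : I -> A) :
    {in r &, forall i j, exists2 c, c != 0 & qcomm c (F i) (G j)} ->
  exists2 c, c != 0 & (\prod_(i <- r) F i) * (\prod_(i <- r) G i) =
                      c *: \prod_(i <- r) (F i * G i).
Proof.
elim: r => [|i r IH] h.
  by exists 1; rewrite ?oner_eq0 // !big_nil mulr1 scale1r.
have [|c c0 Ec] := IH; first by move=> j k jr kr; apply: h; rewrite inE ?jr ?kr orbT.
have [j jr|d d0 Ed] := @qcomm_prod_l _ r F (G i).
  by apply: h; rewrite ?mem_head // inE jr orbT.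
exists (d * c); first exact: mulf_neq0.
rewrite !big_cons -mulrA [X in F i * X]mulrA Ed -scalerAl -[G i * _ * _]mulrA Ec.
by rewrite -!scalerAr scalerA mulrA.
Qed.
End QuasiCommutation.

Section Monomials.
Context {K : fieldType} {D : unitAlgType K} {I : choiceType}.
Variables (q s : K) (le : rel I) (S : seed D I) (e : I -> int).
Hypotheses (q0 : q != 0) (s0 : s != 0) (s2 : s ^+ 2 = q).
Local Notation X u := (cvar S u ^ e u).
Local Notation L := (lmat S).

(** The monomials of an exchange relation involve three variables. Written in
  this form, for a chosen order of the factors, they do not depend on it. *)
Definition monomial3 u v w : D :=
  s ^ (e u * e v * L v u + e u * e w * L w u + e v * e w * L w v)
    *: (X u * (X v * X w)).

Definition qcommuting u v : Prop :=
  [/\ cvar S u \is a GRing.unit, cvar S v \is a GRing.unit,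
      qcomm (q ^ L u v) (cvar S u) (cvar S v) & L u v = - L v u].

(** Exchanging two factors produces the power eu ev L u v of [q], that is, twice
  that power of [s]; this turns the exponent of [s] into its opposite. *)
Lemma qcommuting_pow u v : qcommuting u v ->
  s ^ (e u * e v * L v u) *: (X u * X v) = s ^ (e v * e u * L u v) *: (X v * X u).
Proof.
case=> uU vU uv Luv.
rewrite (qcomm_exprz (e u) (e v) _ uU vU uv) ?expfz_neq0 // scalerA.
rewrite -s2 (exprnP s 2) !exprz_exp -expfzDr //; congr (_ ^ _ *: _).
by rewrite Luv; ring.
Qed.

Lemma monomial3E12 u v w : monomial3 u v w =
  s ^ (e u * e w * L w u + e v * e w * L w v)
    *: ((s ^ (e u * e v * L v u) *: (X u * X v)) * X w).
Proof.
rewrite /monomial3 -scalerAl scalerA -expfzDr // mulrA.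
by congr (s ^ _ *: _); ring.
Qed.

Lemma monomial3E23 u v w : monomial3 u v w =
  s ^ (e u * e v * L v u + e u * e w * L w u)
    *: (X u * (s ^ (e v * e w * L w v) *: (X v * X w))).
Proof. by rewrite /monomial3 -scalerAr scalerA -expfzDr. Qed.

Lemma monomial3_swap12 u v w : qcommuting u v ->
  monomial3 u v w = monomial3 v u w.
Proof. by move=> uv; rewrite !monomial3E12 (qcommuting_pow uv) addrC. Qed.

Lemma monomial3_swap23 u v w : qcommuting v w ->
  monomial3 u v w = monomial3 u w v.
Proof. by move=> vw; rewrite !monomial3E23 (qcommuting_pow vw) addrC. Qed.

Lemma monomial3_perm u v w x y z : uniq [:: x; y; z] ->
    {in [:: x; y; z] &, forall i j, i != j -> qcommuting i j} ->
    perm_eq [:: u; v; w] [:: x; y; z] ->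
  monomial3 u v w = monomial3 x y z.
Proof.
move=> U h p; have U' := perm_uniq p; rewrite U in U'.
have mem := perm_mem p.
have [hu hv hw] : [/\ u \in [:: x; y; z], v \in [:: x; y; z] & w \in [:: x; y; z]].
  by rewrite -!mem !inE !eqxx !orbT.
move: U U'; rewrite /= !inE !negb_or !andbT => /andP[/andP[xy xz] yz].
have [yx zx zy] : [/\ y != x, z != x & z != y] by split; rewrite eq_sym.
have H i j : i \in [:: x; y; z] -> j \in [:: x; y; z] -> i != j -> qcommuting i j.
  by move=> ii jj; exact: h.
have [mx my mz] : [/\ x \in [:: x; y; z], y \in [:: x; y; z] & z \in [:: x; y; z]].
  by rewrite !inE !eqxx !orbT.
have Hxy := H _ _ mx my xy; have Hxz := H _ _ mx mz xz; have Hyz := H _ _ my mz yz.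
move: hu hv hw; rewrite !inE.
move=> /or3P[]/eqP-> /or3P[]/eqP-> /or3P[]/eqP-> //; rewrite ?eqxx ?andbF //= => _.
- by rewrite (monomial3_swap23 _ Hyz).
- by rewrite -(monomial3_swap12 _ Hxy).
- by rewrite -(monomial3_swap23 _ Hxz) -(monomial3_swap12 _ Hxy).
- by rewrite -(monomial3_swap12 _ Hxz) (monomial3_swap23 _ Hyz).
- by rewrite -(monomial3_swap23 _ Hxy) -(monomial3_swap12 _ Hxz) (monomial3_swap23 _ Hyz).
Qed.

Hypotheses (le_total : total le) (le_trans : transitive le) (le_anti : antisymmetric le).

Lemma qmonomial_monomial3 x y z : uniq [:: x; y; z] ->
    {in [:: x; y; z] &, forall i j, i != j -> qcommuting i j} ->
    (forall i, (e i != 0) = (i \in [:: x; y; z])) ->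
  qmonomial s le S e = monomial3 x y z.
Proof.
move=> U h supp; rewrite /qmonomial.
have fin : finite_set [set v | e v != 0].
  rewrite (_ : [set v | e v != 0] = [set` [:: x; y; z]]); first exact: finite_seq.
  by apply/seteqP; split=> v /=; rewrite supp.
have Ur : uniq (exp_support le e) by rewrite sort_uniq; exact: fset_uniq.
have p : perm_eq (exp_support le e) [:: x; y; z].
  apply: uniq_perm => // v; rewrite mem_sort.
  rewrite (in_fset_set fin) -supp.
  by apply/idP/idP => [/set_mem //|ev]; apply/mem_set.
have : sorted le (exp_support le e) by exact: sort_sorted.
have := perm_size p; move: p Ur.
case: (exp_support le e) => [|u [|v [|w [|? ?]]]] //= p U' _ /and3P[uv vw _].
have uw := le_trans uv vw.
rewrite -(monomial3_perm U h p) /monomial3 !big_cons !big_nil !mulr1 !addr0.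
move: U'; rewrite !inE !negb_or !andbT => /andP[/andP[n1 n2] n3].
have gt i j : le i j -> i != j -> le j i = false.
  by move=> ij; apply: contraNF => ji; apply/eqP/le_anti; rewrite ij.
have [gvu gwu gwv] := And3 (gt _ _ uv n1) (gt _ _ uw n2) (gt _ _ vw n3).
rewrite !eqxx !andbF uv vw uw n1 n2 n3 gvu gwu gwv /=.
by congr (s ^ _ *: _); ring.
Qed.
End Monomials.

(** * Pluecker coordinates *)

Arguments comm_matrix : simpl never.

Section Pluckers.
Context {K : fieldType} (q s : K).
Hypotheses (q0 : q != 0) (s2 : s ^+ 2 = q).
Local Notation P v := (qplucker q v.1 v.2).

Lemma qGr_valM (x y : qGr q) : val (x * y) = val x * val y.
Proof. exact: (rmorphM (val : qGr q -> qmat q)). Qed.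
Lemma qGr_valD (x y : qGr q) : val (x + y) = val x + val y.
Proof. exact: (raddfD (val : qGr q -> qmat q)). Qed.
Lemma qGr_valZ a (x : qGr q) : val (a *: x) = a *: val x.
Proof. exact: GRing.valZ. Qed.
Lemma qGr_val1 : val (1 : qGr q) = 1.
Proof. exact: (rmorph1 (val : qGr q -> qmat q)). Qed.
Lemma qGr_val0 : val (0 : qGr q) = 0.
Proof. exact: (raddf0 (val : qGr q -> qmat q)). Qed.

Lemma qplucker_comm (x y : chord) : x.1 < x.2 -> y.1 < y.2 -> ~ crossing x y ->
  P x * P y = q ^ comm_matrix x y *: (P y * P x).
Proof.
case: x y => [i j] [k l] /= ij kl nc; apply: val_inj.
rewrite qGr_valZ !qGr_valM !val_qplucker //.
have [[oi oj]|[ok ol]] : (i <= k \/ l <= i) /\ (j <= k \/ l <= j) \/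
    (k <= i \/ j <= k) /\ (l <= i \/ j <= l).
  by move: nc; rewrite /crossing /=; lia.
- rewrite comm_matrix_outside //.
  by have := qminor_quasicomm q0 1 kl oi oj; rewrite !mulr1.
- rewrite comm_matrix_outside_r //.
  have := qminor_quasicomm q0 1 ij ok ol; rewrite !mulr1 => ->.
  by rewrite scalerA -expfzDr // addNr scale1r.
Qed.

(** With the normalizations of the two monomials in the mutation rule as powers of
  [s], both positions of the diagonal give the same formula. *)
Lemma qplucker_exchange t (o n p1 m1 p2 m2 : chord) :
    is_flip t o n p1 m1 p2 m2 ->
  P o * P n =
    s ^ (- comm_matrix p1 o - comm_matrix p2 o + comm_matrix p2 p1)
      *: (P p1 * P p2) +
    s ^ (- comm_matrix m1 o - comm_matrix m2 o + comm_matrix m2 m1)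
      *: (P m1 * P m2).
Proof.
have s0 : s != 0 by apply: contraNneq q0 => s0; rewrite -s2 s0 expr0n.
have sV : s ^ (-2) = q^-1 by rewrite -s2 -invr_expz.
case=> a b c d ab bc cd _ _ _ _ _; have [ac bd] := (lt_trans ab bc, lt_trans bc cd);
  have ad := lt_trans ab bd; apply: val_inj;
  rewrite qGr_valD !qGr_valZ !qGr_valM !val_qplucker //.
- have -> : - comm_matrix (a, b) (a, c) - comm_matrix (c, d) (a, c) +
      comm_matrix (c, d) (a, b) = -2.
    by rewrite ?[comm_matrix (a, d) _]comm_matrix_outside ?comm_matrix_outside_r
      /side_sign; lia.
  have -> : - comm_matrix (b, c) (a, c) - comm_matrix (a, d) (a, c) +
      comm_matrix (a, d) (b, c) = 2.
    by rewrite ?[comm_matrix (a, d) _]comm_matrix_outside ?comm_matrix_outside_r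
      /side_sign; lia.
  have := qminor_exchange_13 q0 1 ab bc cd; rewrite !mulr1 => ->.
  by rewrite sV -s2.
- have -> : - comm_matrix (a, d) (b, d) - comm_matrix (b, c) (b, d) +
      comm_matrix (b, c) (a, d) = -2.
    by rewrite ?[comm_matrix (a, d) _]comm_matrix_outside ?comm_matrix_outside_r
      /side_sign; lia.
  have -> : - comm_matrix (a, b) (b, d) - comm_matrix (c, d) (b, d) +
      comm_matrix (c, d) (a, b) = -2.
    by rewrite ?[comm_matrix (a, d) _]comm_matrix_outside ?comm_matrix_outside_r
      /side_sign; lia.
  have := qminor_exchange_24 q0 1 ab bc cd; rewrite !mulr1 => ->.
  by rewrite sV.
Qed.

Lemma qplucker_monomials_free (l : seq chord) (n : nat)
    (e : 'I_n -> chord -> nat) (k : 'I_n -> K) :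
    uniq l -> {in l &, forall v w, ~ crossing v w} ->
    {in l, forall v, v.1 < v.2} ->
    (forall i j, {in l, e i =1 e j} -> i = j) ->
    \sum_(i < n) k i *: \prod_(v <- l) P v ^+ e i v = 0 ->
  forall i, k i = 0.
Proof.
move=> ul nc lt12 inj_e /(congr1 val) sum0.
apply: (qminor_monomials_free q0 ul nc lt12 inj_e).
rewrite -[RHS]qGr_val0 -[in RHS]sum0.
rewrite (big_morph val qGr_valD qGr_val0); apply: eq_bigr => i _.
rewrite qGr_valZ (big_morph val qGr_valM qGr_val1); congr (_ *: _).
apply: eq_big_seq => v vl; elim: (e i v) => [|m IH]; first by rewrite qGr_val1.
by rewrite !exprS qGr_valM -IH val_qplucker // lt12.
Qed.

Lemma qplucker_neq0 (v : chord) : v.1 < v.2 -> P v != 0.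
Proof.
move=> v12; apply/eqP => P0; have := oner_neq0 K; rewrite (_ : 1 = 0) ?eqxx //.
apply: (@qplucker_monomials_free [:: v] 1 (fun _ _ => 1%N) (fun _ => 1) _ _ _ _ _ ord0) => //.
- by move=> x y; rewrite !inE => /eqP -> /eqP ->; rewrite /crossing; lia.
- by move=> x; rewrite inE => /eqP ->.
- by move=> i j _; rewrite !ord1.
- by rewrite big_ord1 big_seq1 P0 expr1 scaler0.
Qed.
End Pluckers.

(** * Seeds labelled by triangulations *)

Lemma chord_le_total : total chord_le.
Proof. by move=> [a b] [c d]; rewrite /chord_le /=; lia. Qed.

Lemma chord_le_trans : transitive chord_le.
Proof. by move=> [a b] [c d] [i j]; rewrite /chord_le /=; lia. Qed.

Lemma chord_le_anti : antisymmetric chord_le.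
Proof.
move=> [a b] [c d]; rewrite /chord_le /= => h.
by have [-> ->] : a = c /\ b = d by lia.
Qed.

Section MutableFlip.
Variables (t : set chord) (o n p1 m1 p2 m2 : chord).
Hypothesis tT : triangulation t.
Hypothesis fT : is_flip t o n p1 m1 p2 m2.

(** If [n] joined a left-fountain to a right-fountain, then [o], which crosses
  it, would have a fountain strictly inside. *)
Lemma mutable_flip_new : mutable (flip t o n) n.
Proof.
have tT' := flip_triangulation tT fT; have Vo : vertices t o by left; exact: flip_old fT.
have cr := flip_crossing fT; have tn : flip t o n n by right.
suff h i j : n = (i, j) -> mutable (flip t o n) (i, j).
  by have := h _ _ (surjective_pairing n); rewrite -surjective_pairing.
move=> En; apply/(mutableP tT'); split=> [|[fi fj]]; first by rewrite -En.
have {}fi : left_fountain t i := proj1 (flip_left_fountain t o n i) fi.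
have {}fj : right_fountain t j := proj1 (flip_right_fountain t o n j) fj.
move: cr; rewrite En; case: (o) Vo => k l Vo; rewrite /crossing /=.
have := left_fountain_arc tT fi Vo; have := right_fountain_arc tT fj Vo.
by lia.
Qed.

Lemma mutable_flip_old x : vertices t x -> x <> o ->
  mutable (flip t o n) x <-> mutable t x.
Proof.
have tT' := flip_triangulation tT fT.
case: x => i j Vx xo.
have xn : (i, j) <> n by move=> xn; apply: (flip_new_notin tT fT); rewrite -xn.
split=> [/(mutableP tT')[tx nf]|/(mutableP tT)[tx nf]];
  [apply/(mutableP tT) | apply/(mutableP tT')]; split.
- by case: tx => [[]|].
- by case=> fi fj; apply: nf; split; [apply/flip_left_fountain | apply/flip_right_fountain].
- by left.
- by case=> /flip_left_fountain fi /flip_right_fountain fj; apply: nf.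
Qed.
End MutableFlip.

Section LabelledSeeds.
Context {K : fieldType} (q s : K) (D : unitAlgType K).
Variable iota : {lrmorphism qGr q -> D}.
Hypotheses (q0 : q != 0) (s2 : s ^+ 2 = q).
Hypothesis D_frac : is_skew_field_of_fractions iota.
Variables (t : set chord).
Hypothesis tT : triangulation t.
Local Notation P v := (qplucker q v.1 v.2).
Local Notation V := (vertices t).
Local Notation mut S b := (mutate s chord_le V S b).

Lemma plucker_unit (v : chord) : v.1 < v.2 -> iota (P v) \is a GRing.unit.
Proof.
move=> v12; apply: (skew_field_unit D_frac).
rewrite -(rmorph0 iota) (inj_eq (skew_field_inj D_frac)).
exact: qplucker_neq0.
Qed.

Lemma vertex_chord_lt t' (v : chord) : triangulation t' -> vertices t' v ->
  v.1 < v.2.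
Proof. by case: v => i j tT' /(vertex_lt tT'). Qed.

(** The seed [S] is the seed of the triangulation [t'], except that the variable
  of the chord [sg a] carries the label [a]. Mutation keeps the labels, whereas
  a flip replaces a chord, so the labelling has to be recorded. *)
Record labelled (S : seed D chord) (t' : set chord) (sg : chord -> chord) :
    Prop := Labelled {
  lab_tri : triangulation t';
  lab_left : forall k, left_fountain t' k <-> left_fountain t k;
  lab_right : forall k, right_fountain t' k <-> right_fountain t k;
  lab_vertex : forall a, V a -> vertices t' (sg a);
  lab_inj : forall a b, V a -> V b -> sg a = sg b -> a = b;
  lab_surj : forall z, vertices t' z -> exists2 a, V a & sg a = z;
  lab_mutable : forall a, V a -> mutable t' (sg a) <-> mutable t a;
  lab_cvar : forall a, V a -> cvar S a = iota (P (sg a));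
  lab_bmat : forall a c, V a -> mutable t c ->
    bmat S a c = arrow_matrix t' (sg a) (sg c);
  lab_lmat : forall a c, V a -> V c ->
    lmat S a c = comm_matrix (sg a) (sg c) }.

Lemma mutable_vertex a : mutable t a -> V a.
Proof. by case; left. Qed.

Lemma labelled_initial : labelled (initial_seed iota t) t id.
Proof.
split=> //; first by move=> z Vz; exists z.
by move=> a c _ mc; rewrite /= exchange_matrixE.
Qed.

Section Mutation.
Variables (S : seed D chord) (t' : set chord) (sg : chord -> chord) (b : chord).
Variables (n p1 m1 p2 m2 x1 y1 x2 y2 : chord).
Hypothesis lab : labelled S t' sg.
Hypothesis mb : mutable t b.
Hypothesis fl : is_flip t' (sg b) n p1 m1 p2 m2.
Hypotheses (Vx1 : V x1) (Vx2 : V x2) (Vy1 : V y1) (Vy2 : V y2).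
Hypotheses (sx1 : sg x1 = p1) (sx2 : sg x2 = p2).
Hypotheses (sy1 : sg y1 = m1) (sy2 : sg y2 = m2).

Let Vb : V b := mutable_vertex mb.
Let tT' := lab_tri lab.

Lemma label_mem a u v x y : V a -> V x -> V y -> sg x = u -> sg y = v ->
  (sg a \in [:: u; v]) = (a \in [:: x; y]).
Proof.
move=> Va Vx Vy su sv; rewrite !inE -su -sv.
by congr (_ || _); apply/eqP/eqP => [/(lab_inj lab)|->]; auto.
Qed.

Lemma label_uniq : uniq [:: b; x1; y1; x2; y2].
Proof.
apply: (@map_uniq _ _ sg); rewrite /= sx1 sx2 sy1 sy2.
exact: flip_uniq fl.
Qed.

Lemma bmat_column a : V a ->
  bmat S a b = (a \in [:: x1; x2])%:Z - (a \in [:: y1; y2])%:Z.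
Proof.
move=> Va; rewrite (lab_bmat lab) // (arrow_matrix_old tT' fl).
by rewrite (label_mem Va Vx1 Vx2) // (label_mem Va Vy1 Vy2).
Qed.

Lemma column_disjoint a : a \in [:: x1; x2] -> a \notin [:: y1; y2].
Proof.
have := label_uniq; rewrite /= !inE !negb_or => /and4P[_ /and3P[? ? ?]].
move=> /andP[? ?] /andP[? _] /orP[]/eqP->; apply/andP; split=> //.
by rewrite eq_sym.
Qed.

Lemma exchange_posE a :
  exchange_pos V S b a = (a \in [:: x1; x2])%:Z - (a == b)%:Z.
Proof.
rewrite /exchange_pos; congr (_ - _); last by case: (a == b).
have [Va|nVa] := asboolP (V a) => /=; last first.
  have na x : V x -> (a == x) = false.
    by move=> Vx; apply/negP => /eqP e; apply: nVa; rewrite e.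
  by rewrite !inE !na.
rewrite bmat_column //; have := @column_disjoint a.
by case: (a \in [:: x1; x2]); case: (a \in [:: y1; y2]) => // /(_ isT).
Qed.

Lemma exchange_negE a :
  exchange_neg V S b a = (a \in [:: y1; y2])%:Z - (a == b)%:Z.
Proof.
rewrite /exchange_neg; congr (_ - _); last by case: (a == b).
have [Va|nVa] := asboolP (V a) => /=; last first.
  have na x : V x -> (a == x) = false.
    by move=> Vx; apply/negP => /eqP e; apply: nVa; rewrite e.
  by rewrite !inE !na.
rewrite bmat_column //; have := @column_disjoint a.
by case: (a \in [:: x1; x2]); case: (a \in [:: y1; y2]) => // /(_ isT).
Qed.

Lemma label_qcommuting u v : V u -> V v -> qcommuting q S u v.
Proof.
move=> Vu Vv; have Wu := lab_vertex lab Vu; have Wv := lab_vertex lab Vv.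
have [lu lv] := (vertex_chord_lt tT' Wu, vertex_chord_lt tT' Wv).
split; rewrite ?(lab_cvar lab) //; try exact: plucker_unit.
- rewrite /qcomm (lab_lmat lab) // -!rmorphM /= qplucker_comm ?linearZ //.
  exact: vertices_nc Wu Wv.
- rewrite !(lab_lmat lab) //; move: lu lv.
  by case: (sg u) (sg v) => [i j] [k l] /= lu lv; exact: comm_matrix_skew.
Qed.

(** Written with the old variable as first factor, so that it can be factored out
  of the sum of the two monomials. *)
Lemma exchange_monomial (e : chord -> int) x y : V x -> V y ->
    uniq [:: b; x; y] ->
    (forall a, e a = (a \in [:: x; y])%:Z - (a == b)%:Z) ->
  qmonomial s chord_le S e =
  s ^ (- comm_matrix (sg x) (sg b) - comm_matrix (sg y) (sg b)
       + comm_matrix (sg y) (sg x))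
   *: ((iota (P (sg b)))^-1 * (iota (P (sg x)) * iota (P (sg y)))).
Proof.
move=> Vx Vy U eE; have s0 : s != 0.
  by apply: contraNneq q0 => s0; rewrite -s2 s0 expr0n.
rewrite (@qmonomial_monomial3 _ _ _ _ _ chord_le _ _ q0 s0 s2 _ _ _ b x y) //.
- move: U; rewrite /= !inE !negb_or !andbT => /andP[/andP[bx b_y] xy].
  rewrite /monomial3 !eE !inE !eqxx !orbT (negPf bx) (negPf b_y).
  rewrite [x == b]eq_sym [y == b]eq_sym (negPf bx) (negPf b_y).
  rewrite !(lab_cvar lab) // !(lab_lmat lab) //=.
  by rewrite !(subr0, sub0r, mul1r, mulN1r, mulNr, expr1z, exprN1).
- exact: chord_le_total.
- exact: chord_le_trans.
- exact: chord_le_anti.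
- have VV i : i \in [:: b; x; y] -> V i.
    by rewrite !inE => /or3P[] /eqP ->.
  by move=> i j ib jb _; apply: label_qcommuting; apply: VV.
move=> a; rewrite eE !inE; move: U; rewrite /= !inE !negb_or !andbT.
move=> /andP[/andP[bx b_y] _].
have [->|ab] := eqVneq a b; first by rewrite (negPf bx) (negPf b_y).
by rewrite subr0; case: (_ || _).
Qed.

Let uniq_x : uniq [:: b; x1; x2] :=
  mask_uniq label_uniq [:: true; true; false; true; false].
Let uniq_y : uniq [:: b; y1; y2] :=
  mask_uniq label_uniq [:: true; false; true; false; true].

Lemma mutate_cvar : cvar (mut S b) b = iota (P n).
Proof.
rewrite /= /mut_cvar eqxx (exchange_monomial Vx1 Vx2 uniq_x exchange_posE).
rewrite (exchange_monomial Vy1 Vy2 uniq_y exchange_negE).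
rewrite sx1 sx2 sy1 sy2 -!rmorphM !scalerAr -mulrDr -!linearZ -rmorphD.
rewrite -(qplucker_exchange q0 s2 fl) rmorphM mulKr //.
by apply: plucker_unit; apply: (vertex_chord_lt tT'); exact: (lab_vertex lab).
Qed.

Lemma mutate_lrow c : V c -> c != b ->
  mut_lrow V S b c = comm_matrix n (sg c).
Proof.
move=> Vc cb.
have Ux : uniq [:: x1; x2] by case/andP: uniq_x.
have Vx x : x \in [:: x1; x2] -> V x by rewrite !inE => /orP[]/eqP->.
have B x : x \in [:: x1; x2] -> bmat S x b = 1.
  move=> xx; rewrite bmat_column ?xx; last exact: Vx.
  by rewrite (negPf (column_disjoint xx)).
have sub : [set` [:: x1; x2]] `<=` [set a | V a /\ 0 < bmat S a b].
  by move=> x xx; split; [exact: Vx | rewrite B].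
rewrite /mut_lrow (fsbigE _ _ Ux sub) => [|a [Va Ba] na]; last first.
  by move: Ba; rewrite bmat_column // (negPf na); case: (a \in [:: y1; y2]).
rewrite big_seq_cond (eq_bigl (fun x => x \in [:: x1; x2])) => [|x]; last first.
  by apply: andb_idr => xx; apply/mem_set/sub.
rewrite -big_seq big_cons big_seq1 !B ?inE ?eqxx ?orbT // !mul1r.
rewrite !(lab_lmat lab) // sx1 sx2 addrA.
have [_ ->] // := flip_comm_matrix tT' fl (lab_vertex lab Vc).
by move/(lab_inj lab Vc Vb) => /eqP; apply/negP.
Qed.

Definition relabel (a : chord) : chord := if a == b then n else sg a.

(** The label [b] passes to the new diagonal, and all other labels stay. *)
Lemma labelled_mutate : labelled (mut S b) (flip t' (sg b) n) relabel.
Proof.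
have tT'' := flip_triangulation tT' fl.
have ne a : V a -> a != b -> sg a <> sg b.
  by move=> Va ab /(lab_inj lab Va Vb)/eqP; apply/negP.
split=> //.
- by move=> k; rewrite -(lab_left lab k); exact: flip_left_fountain.
- by move=> k; rewrite -(lab_right lab k); exact: flip_right_fountain.
- move=> a Va; rewrite /relabel; case: eqVneq => [_|ab].
    exact: (vertices_flip_new tT' fl).
  by apply: (vertices_flip_old tT' fl) (lab_vertex lab Va) (ne a Va ab).
- move=> a c Va Vc; rewrite /relabel.
  have nn d : V d -> sg d <> n.
    by move=> /(lab_vertex lab) + dn; rewrite dn; exact: (flip_new_notin tT' fl).
  case: (eqVneq a b) => [->|ab]; case: (eqVneq c b) => [->|cb] //.
  + by move/esym/nn => /(_ Vc).
  + by move/nn => /(_ Va).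
  + exact: (lab_inj lab).
- move=> z /(vertices_flip tT' fl)[[Vz zo]|->].
    have [a Va az] := lab_surj lab Vz; exists a => //; rewrite /relabel.
    by case: eqVneq => // ab; case: zo; rewrite -az ab.
  by exists b => //; rewrite /relabel eqxx.
- move=> a Va; rewrite /relabel; case: eqVneq => [->|ab].
    by split=> _; [exact: mb | exact: (mutable_flip_new tT' fl)].
  rewrite -(lab_mutable lab Va).
  exact: (mutable_flip_old tT' fl (lab_vertex lab Va) (ne a Va ab)).
- move=> a Va; rewrite /relabel; case: eqVneq => [->|ab]; first exact: mutate_cvar.
  by rewrite /= /mut_cvar (negPf ab) (lab_cvar lab).
- move=> a c Va mc; have Vc := mutable_vertex mc.
  have B := lab_bmat lab.
  have A0 u v : arrow_matrix u v v = 0 by rewrite /arrow_matrix subrr.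
  rewrite /= /mut_bmat /relabel.
  case: (eqVneq a b) => [->|ab]; case: (eqVneq c b) => [->|cb] /=.
  + by rewrite B // !A0 oppr0.
  + by rewrite B // -arrow_matrix_skew [RHS]arrow_matrix_skew (arrow_matrix_new tT' fl) opprK.
  + by rewrite B // (arrow_matrix_new tT' fl).
  + rewrite !B // (arrow_matrix_flip tT' fl (lab_vertex lab Va) (lab_vertex lab Vc)) //.
      exact: ne.
    exact: ne.
- move=> a c Va Vc; rewrite /= /mut_lmat /relabel.
  have [ab|ab] := eqVneq a b; have [cb|cb] := eqVneq c b.
  + have := vertex_chord_lt tT'' (vertices_flip_new tT' fl).
    by case: (n) => i j /= ij; rewrite /comm_matrix !eqxx ij.
  + exact: mutate_lrow.
  + rewrite mutate_lrow //.
    have := vertex_chord_lt tT' (lab_vertex lab Va).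
    have := vertex_chord_lt tT'' (vertices_flip_new tT' fl).
    by case: (n) (sg a) => [i j] [k l] /= nn aa; rewrite -comm_matrix_skew.
  + exact: (lab_lmat lab).
Qed.
End Mutation.
End LabelledSeeds.

(** * Cluster variables *)

Lemma subalg_gen_sub (K : fieldType) (A : algType K) (X Y : set A) :
  GRing.subalg_closed (fun x => x \in Y) -> X `<=` Y -> subalg_gen X `<=` Y.
Proof. by move=> Yc XY x; apply. Qed.

Section Subalgebras.
Context {K : fieldType} {A B : algType K}.

Lemma subalg_gen_image (f : {lrmorphism A -> B}) (X : set A) :
  subalg_gen (f @` X) = f @` subalg_gen X.
Proof.
apply/seteqP; split.
  have [c1 cl cm] := subalg_gen_closed X.
  have mem x : x \in subalg_gen X -> f x \in f @` subalg_gen X.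
    by move=> /set_mem Xx; apply/mem_set; exists x.
  apply: (@subalg_gen_sub _ _ (f @` X)); last first.
    by move=> _ [x Xx <-]; exists x => //; exact: sub_subalg_gen.
  split.
  - by rewrite -(rmorph1 f); exact: mem.
  - move=> a _ _ /set_mem[x Xx <-] /set_mem[y Xy <-].
    by rewrite -linearP; apply/mem/cl; apply/mem_set.
  - move=> _ _ /set_mem[x Xx <-] /set_mem[y Xy <-].
    by rewrite -rmorphM; apply/mem/cm; apply/mem_set.
have [c1 cl cm] := subalg_gen_closed (f @` X).
move=> _ [x Xx <-]; move: x Xx; apply: (@subalg_gen_sub _ _ X (f @^-1` subalg_gen (f @` X))).
  split.
  - by rewrite inE /= rmorph1; exact: set_mem.
  - by move=> a x y; rewrite !inE /= linearP => /mem_set hx /mem_set hy; apply/set_mem/cl.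
  - by move=> x y; rewrite !inE /= rmorphM => /mem_set hx /mem_set hy; apply/set_mem/cm.
by move=> x Xx; apply: sub_subalg_gen; exists x.
Qed.
End Subalgebras.

Lemma qGr_plucker_gen (K : fieldType) (q : K) :
  plucker_subalg q (fun _ _ => True) = setT.
Proof.
apply/seteqP; split=> // x _; rewrite /plucker_subalg; set X := (X in subalg_gen X).
have [c1 cl cm] := subalg_gen_closed X.
have sub : qgr_set q `<=` [set y | exists2 x, subalg_gen X x & val x = y].
  apply: (@subalg_gen_sub _ (qmat q)); last first.
    move=> _ [[i j] /= ij <-]; exists (qplucker q i j); last exact: val_qplucker.
    by apply: sub_subalg_gen; exists (i, j).
  split.
  - by apply/mem_set; exists 1; [exact: set_mem | exact: qGr_val1].
  - move=> a _ _ /set_mem[y /mem_set Xy <-] /set_mem[z /mem_set Xz <-].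
    apply/mem_set; exists (a *: y + z); first exact/set_mem/cl.
    by rewrite qGr_valD qGr_valZ.
  - move=> _ _ /set_mem[y /mem_set Xy <-] /set_mem[z /mem_set Xz <-].
    apply/mem_set; exists (y * z); first exact/set_mem/cm.
    by rewrite qGr_valM.
have /sub[y Xy /val_inj <-] // : qgr_set q (val x).
by apply/set_mem; case: x.
Qed.

Section ClusterVariables.
Context {K : fieldType} (q s : K) (D : unitAlgType K).
Variable iota : {lrmorphism qGr q -> D}.
Hypotheses (q0 : q != 0) (s2 : s ^+ 2 = q).
Hypothesis D_frac : is_skew_field_of_fractions iota.
Variables (t : set chord).
Hypothesis tT : triangulation t.
Local Notation P v := (qplucker q v.1 v.2).
Local Notation V := (vertices t).
Local Notation S0 := (initial_seed iota t).
Local Notation mut S b := (mutate s chord_le V S b).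

Lemma labelled_flip S t' sg b (n p1 m1 p2 m2 : chord) :
    labelled iota t S t' sg -> mutable t b ->
    is_flip t' (sg b) n p1 m1 p2 m2 ->
  labelled iota t (mut S b) (flip t' (sg b) n) (relabel sg b n).
Proof.
move=> lab mb fl; have [Vp1 Vm1 Vp2 Vm2] := flip_edges fl.
have [x1 V1 s1] := lab_surj lab Vp1; have [x2 V2 s2'] := lab_surj lab Vp2.
have [y1 W1 r1] := lab_surj lab Vm1; have [y2 W2 r2] := lab_surj lab Vm2.
exact: (labelled_mutate q0 s2 D_frac lab mb fl V1 V2 W1 W2).
Qed.

Lemma labelled_foldl bs : (forall b, b \in bs -> mutable t b) ->
  exists t' sg, labelled iota t (foldl (mutate s chord_le V) S0 bs) t' sg.
Proof.
elim/last_ind: bs => [|bs b IH] mbs; first by exists t, id; exact: labelled_initial.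
have [|t' [sg lab]] := IH; first by move=> c cb; apply: mbs; rewrite mem_rcons inE cb orbT.
have mb : mutable t b by apply: mbs; rewrite mem_rcons mem_head.
have : mutable t' (sg b) by apply/(lab_mutable lab) => //; exact: mutable_vertex.
case E : (sg b) => [i j] mij.
have [n [p1 [m1 [p2 [m2 fl]]]]] := flip_exists (lab_tri lab) mij.
rewrite -E in fl; do 2 eexists; rewrite -cats1 foldl_cat /=.
exact: labelled_flip lab mb fl.
Qed.

Lemma labelled_reach t' : flip_reach t t' ->
  exists bs sg, (forall b, b \in bs -> mutable t b) /\
    labelled iota t (foldl (mutate s chord_le V) S0 bs) t' sg.
Proof.
elim=> [|{}t' o n p1 m1 p2 m2 _ [bs [sg [mbs lab]]] fl mo].
  by exists [::], id; split=> //; exact: labelled_initial.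
have [b Vb so] := lab_surj lab (mutable_vertex mo).
have mb : mutable t b by apply/(lab_mutable lab) => //; rewrite so.
exists (rcons bs b), (relabel sg b n); split.
  by move=> c; rewrite mem_rcons inE => /predU1P[->|/mbs].
by rewrite -cats1 foldl_cat /= -so; apply: labelled_flip lab mb _; rewrite so; exact: fl.
Qed.

(** The first condition on [Q] bounds the chords that flips can produce; it sees
  the flipped triangulations only through their fountains. The second one makes
  every chord satisfying [Q] reachable. *)
Lemma cluster_variables_plucker (Q : int -> int -> Prop) :
    (forall t' i j, triangulation t' ->
       (forall k, left_fountain t' k <-> left_fountain t k) ->
       (forall k, right_fountain t' k <-> right_fountain t k) ->
       vertices t' (i, j) -> Q i j) ->
    (forall i j, i < j -> Q i j -> inside_nonfountain t i j) ->
  cluster_variables s chord_le V (mutable t) S0 =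
  iota @` [set P p | p in [set p : int * int | p.1 < p.2 /\ Q p.1 p.2]].
Proof.
move=> HQ1 HQ2; apply/seteqP; split=> [_ [bs mbs [a Va ->]]|_ [_ [[i j] [/= ij Qij] <-] <-]].
  have [t' [sg lab]] := labelled_foldl mbs.
  have Vs := lab_vertex lab Va.
  rewrite (lab_cvar lab Va); exists (P (sg a)) => //; exists (sg a) => //.
  split; first exact: vertex_chord_lt (lab_tri lab) Vs.
  apply: (HQ1 t'); [exact: lab_tri lab|exact: lab_left lab|exact: lab_right lab|].
  by rewrite -surjective_pairing.
have [t' [tr Vij]] := flip_reach_chord tT ij (HQ2 i j ij Qij).
have [bs [sg [mbs lab]]] := labelled_reach tr.
have [a Va sa] := lab_surj lab Vij.
by exists bs => //; exists a => //; rewrite (lab_cvar lab Va) sa.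
Qed.

Lemma exp_supportE (e : chord -> int) : exponent V e ->
  exp_support chord_le e =i [pred v | e v != 0].
Proof.
move=> [fin _] v; rewrite mem_sort (in_fset_set fin) inE.
by apply/idP/idP => [/set_mem //|ev]; apply/mem_set.
Qed.

Lemma exp_support_filter (e : chord -> int) (l : seq chord) : exponent V e ->
    uniq l -> sorted chord_le l -> {subset exp_support chord_le e <= l} ->
  exp_support chord_le e = [seq v <- l | e v != 0].
Proof.
move=> eV ul sl sub; apply: (sorted_eq chord_le_trans chord_le_anti).
- by apply: sort_sorted; exact: chord_le_total.
- exact: sorted_filter chord_le_trans _ _ sl.
apply: uniq_perm; rewrite ?filter_uniq // ?sort_uniq ?fset_uniq // => v.
rewrite mem_filter exp_supportE // inE; case: eqP => //= /eqP ev.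
by apply/esym/sub; rewrite exp_supportE.
Qed.

Lemma qmonomial_seq (e : chord -> int) (l : seq chord) : exponent V e ->
    uniq l -> sorted chord_le l -> {subset exp_support chord_le e <= l} ->
  exists2 c : K, c != 0 & qmonomial s chord_le S0 e =
    c *: \prod_(v <- l) iota (P v) ^ e v.
Proof.
move=> eV ul sl sub; eexists; last first.
  rewrite /qmonomial; congr (_ *: _).
  rewrite [in LHS](exp_support_filter eV ul sl sub) big_filter big_mkcond.
  by apply: eq_bigr => v _; case: eqP => [->|_]; rewrite ?expr0z.
by apply: expfz_neq0; apply: contraNneq q0 => s0; rewrite -s2 s0 expr0n.
Qed.

(** Multiplying by a high power of all variables that occur reduces Laurent
  monomials to ordinary ones. *)
Lemma initial_torus : generates_quantum_torus s chord_le V S0.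
Proof.
move=> n e k inj_e eV sum0.
pose l := sort chord_le (undup (flatten [seq exp_support chord_le (e i) | i <- enum 'I_n])).
have ul : uniq l by rewrite sort_uniq undup_uniq.
have sl : sorted chord_le l by apply: sort_sorted; exact: chord_le_total.
have suppl i : {subset exp_support chord_le (e i) <= l}.
  move=> v vi; rewrite mem_sort mem_undup; apply/flatten_mapP.
  by exists i => //; rewrite mem_enum.
have lV v : v \in l -> V v.
  rewrite mem_sort mem_undup => /flatten_mapP[i _].
  by rewrite exp_supportE //; case: (eV i) => _; exact.
have llt v : v \in l -> v.1 < v.2 by move/lV; exact: vertex_chord_lt.
pose N := (\sum_(i < n) \sum_(v <- l) absz (e i v))%N.
have leN i v : v \in l -> (absz (e i v) <= N)%N.
  move=> vl; rewrite /N (bigD1 i) //= (bigD1_seq v) //=; lia.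
pose f i v := absz (e i v + N%:Z).
have fE i v : v \in l -> (f i v)%:Z = e i v + N%:Z.
  by move=> vl; have := leN i v vl; rewrite /f; lia.
have Pu v : v \in l -> iota (P v) \is a GRing.unit.
  by move=> vl; apply: plucker_unit q0 D_frac _ _; exact: llt.
have E i : exists2 c : K, c != 0 &
    qmonomial s chord_le S0 (e i) * \prod_(v <- l) iota (P v) ^ N%:Z =
    c *: iota (\prod_(v <- l) P v ^+ f i v).
  have [c c0 ->] := qmonomial_seq (eV i) ul sl (suppl i).
  have [|d d0 Ed] := @qcomm_prod_mul K D _ l (fun v => iota (P v) ^ e i v)
    (fun v => iota (P v) ^ N%:Z).
    move=> v w vl wl; exists ((q ^ comm_matrix v w) ^ (e i v * N%:Z)).
      by rewrite !expfz_neq0.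
    apply: qcomm_exprz; rewrite ?expfz_neq0 //; try exact: Pu.
    rewrite /qcomm -!rmorphM /= qplucker_comm ?linearZ //; try exact: llt.
    by apply: (vertices_nc tT); exact: lV.
  exists (c * d); first exact: mulf_neq0.
  rewrite -scalerAl Ed scalerA rmorph_prod; congr (_ *: _).
  apply: eq_big_seq => v vl; rewrite rmorphXn /=.
  by rewrite -exprzDr ?Pu // -fE.
have /choice[c cP] i : exists c : K, c != 0 /\
    qmonomial s chord_le S0 (e i) * \prod_(v <- l) iota (P v) ^ N%:Z =
    c *: iota (\prod_(v <- l) P v ^+ f i v).
  by have [c] := E i; exists c.
have {}sum0 : \sum_(i < n) (k i * c i) *: \prod_(v <- l) P v ^+ f i v = 0.
  apply: (skew_field_inj D_frac); rewrite rmorph0 rmorph_sum /=.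
  rewrite -[RHS](mul0r (\prod_(v <- l) iota (P v) ^ N%:Z)) -[in RHS]sum0.
  rewrite mulr_suml; apply: eq_bigr => i _.
  by rewrite -scalerAl; case: (cP i) => _ ->; rewrite linearZ /= scalerA.
move=> i; have : k i * c i = 0.
  apply: (qplucker_monomials_free q0 ul _ llt _ sum0).
    by move=> v w vl wl; apply: (vertices_nc tT); exact: lV.
  move=> j j' fjj; apply: inj_e; apply/funext => v.
  have [vl|vl] := boolP (v \in l).
    by have := fE j v vl; have := fE j' v vl; rewrite (fjj v vl); lia.
  have z m : e m v = 0.
    apply/eqP; apply: contraNT vl => ev; apply: (suppl m).
    by rewrite exp_supportE.
  by rewrite !z.
move/eqP; rewrite mulf_eq0; case: (cP i) => /negPf -> _.
by rewrite orbF => /eqP.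
Qed.

Lemma initial_quantum_seed :
  quantum_seed q s chord_le V (mutable t) S0.
Proof.
have lt_V := fun v => @vertex_chord_lt t v tT.
split.
- move=> a b Va Vb; rewrite /= -!rmorphM /= qplucker_comm ?linearZ //; try exact: lt_V.
  exact: vertices_nc Va Vb.
- move=> [i j] [k l] /lt_V /= ij /lt_V /= kl; exact: comm_matrix_skew.
- exact: initial_torus.
- move=> [i j] mb; have [n [p1 [m1 [p2 [m2 fl]]]]] := flip_exists tT mb.
  apply: (@sub_finite_set _ _ [set` [:: p1; p2; m1; m2]]); last exact: finite_seq.
  move=> a [Va]; rewrite /= exchange_matrixE // (arrow_matrix_old tT fl).
  by rewrite !inE; case: (a == p1); case: (a == p2); case: (a == m1); case: (a == m2).
- exists 2 => // -[i j] a mb Va.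
  have [n [p1 [m1 [p2 [m2 fl]]]]] := flip_exists tT mb.
  have [V1 V2 V3 V4] := flip_edges fl.
  have U := mask_uniq (flip_uniq fl) [:: false; true; true; true; true].
  have sub : [set` [:: p1; m1; p2; m2]] `<=` V.
    by move=> x /=; rewrite !inE => /or4P[] /eqP->.
  have B x : bmat S0 x (i, j) = (x \in [:: p1; p2])%:Z - (x \in [:: m1; m2])%:Z.
    by rewrite /= exchange_matrixE // (arrow_matrix_old tT fl).
  rewrite (fsbigE _ _ U sub) => [|x _ nx]; last first.
    move: nx; rewrite B !inE !negb_or => /and4P[/negPf -> /negPf -> /negPf -> /negPf ->].
    by rewrite subrr mul0r.
  rewrite big_seq_cond (eq_bigl (fun x => x \in [:: p1; m1; p2; m2])) => [|x]; last first.
    by apply: andb_idr => xx; apply/mem_set/sub.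
  rewrite -big_seq !big_cons big_nil !B.
  have -> : (a == (i, j))%:R = (a == (i, j))%:Z :> int by case: (a == (i, j)).
  have [<- _] := flip_comm_matrix tT fl Va.
  move: U; rewrite /= !inE !negb_or !andbT => /and3P[/and3P[a1 a2 a3] /andP[a4 a5] a6].
  rewrite !eqxx (negPf a1) (negPf a3) (negPf a4) (negPf a6).
  rewrite [m1 == p1]eq_sym [m2 == p1]eq_sym [p2 == m1]eq_sym [m2 == p2]eq_sym.
  by rewrite (negPf a1) (negPf a3) (negPf a4) (negPf a6) ?orbT /=; ring.
Qed.

Lemma yields_qcaP F (Q : int -> int -> Prop) : frozen t = F ->
    (forall t' i j, triangulation t' ->
       (forall k, left_fountain t' k <-> left_fountain t k) ->
       (forall k, right_fountain t' k <-> right_fountain t k) ->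
       vertices t' (i, j) -> Q i j) ->
    (forall i j, i < j -> Q i j -> inside_nonfountain t i j) ->
  yields_qca s iota t F (plucker_subalg q Q).
Proof.
move=> frE HQ1 HQ2; split=> //; first exact: initial_quantum_seed.
by rewrite (cluster_variables_plucker HQ1 HQ2) subalg_gen_image.
Qed.

End ClusterVariables.

(** * The three kinds of triangulations *)

Lemma sides_frozen t : triangulation t -> sides `<=` frozen t.
Proof.
move=> tT _ [n _ <-]; split; first by right; exists n.
by case=> /(arc_len tT); lia.
Qed.

Lemma frozen_sides t : triangulation t ->
  (forall l r, ~ split_fountain t l r) -> frozen t = sides.
Proof.
move=> tT ns; apply/seteqP; split; last exact: sides_frozen.
move=> a [[ta|//] na]; case: na; split=> // -[l [r [sf _]]].
exact: ns sf.
Qed.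

(** The chord [(l, r)] belongs to the triangulation: a chord crossing it would
  have a fountain strictly inside. *)
Lemma frozen_split t l r : triangulation t -> split_fountain t l r ->
  frozen t = sides `|` [set (l, r)].
Proof.
move=> tT sf; have [fl fr lr] := sf; apply/seteqP; split.
  move=> a [[ta|sa] na]; last by left.
  right; apply: contrapT => alr; apply: na; split=> // -[l' [r' [[fl' fr' _] E]]].
  by apply: alr; rewrite E (left_fountain_uniq tT fl' fl) (right_fountain_uniq tT fr' fr).
move=> a [sa|->]; first exact: sides_frozen sa.
split; last by case=> _; apply; exists l, r.
have lr' : l < r by have := left_right_fountain tT fl fr; lia.
apply: vertex_max => // k m Vkm h1 h2 h3.
  by have := right_fountain_arc tT fr Vkm; lia.
by have := left_fountain_arc tT fl Vkm; lia.
Qed.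

Theorem corollary4p5 (R : realType) (q s : R[i]) (q_neq0 : q != 0)
    (s_sqrt : s ^+ 2 = q)
    (D : unitAlgType R[i]) (iota : {lrmorphism qGr q -> D})
    (D_frac : is_skew_field_of_fractions iota)
    (t : set chord) (t_triang : triangulation t) :
  [/\ locally_finite t ->
        yields_qca s iota t sides setT,
      forall k : int, fountain t k ->
        yields_qca s iota t sides
          (plucker_subalg q (fun i j => j <= k \/ k <= i)) &
      forall l r : int, split_fountain t l r ->
        yields_qca s iota t (sides `|` [set (l, r)])
          (plucker_subalg q (fun i j => [\/ j <= l, l <= i /\ j <= r | r <= i]))].
Proof.
have tT := t_triang.
split=> [lf|k [fk gk]|l r sf].
- have nf n : ~ left_fountain t n /\ ~ right_fountain t n.
    have fin := lf n; split; apply.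
      apply: (@sub_finite_set _ _ (fst @` [set a | t a /\ (a.1 = n \/ a.2 = n)])).
        by move=> m tm; exists (m, n) => //; split=> //; right.
      exact: finite_image.
    apply: (@sub_finite_set _ _ (snd @` [set a | t a /\ (a.1 = n \/ a.2 = n)])).
      by move=> m tm; exists (n, m) => //; split=> //; left.
    exact: finite_image.
  rewrite -(qGr_plucker_gen q); apply: (yields_qcaP q_neq0 s_sqrt D_frac tT) => //.
  + by apply: frozen_sides => // l r [fl _ _]; case: (nf l).
  + by move=> i j _ _ n _ _; exact: nf.
- apply: (yields_qcaP q_neq0 s_sqrt D_frac tT) => //.
  + apply: frozen_sides => // l r [fl fr]; apply.
    by rewrite (left_fountain_uniq tT fl fk) (right_fountain_uniq tT fr gk).
  + move=> t' i j tT' fl _ Vij.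
    exact: (left_fountain_arc tT' (proj2 (fl k) fk) Vij).
  + move=> i j ij ijk n i_n nj; split=> fn.
      by have := left_fountain_uniq tT fk fn; lia.
    by have := right_fountain_uniq tT gk fn; lia.
- have [fl fr lr] := sf; have ler := left_right_fountain tT fl fr.
  apply: (yields_qcaP q_neq0 s_sqrt D_frac tT) => //.
  + exact: frozen_split.
  + move=> t' i j tT' fl' fr' Vij.
    have [jl|li] := left_fountain_arc tT' (proj2 (fl' l) fl) Vij; first by constructor 1.
    have [jr|ri] := right_fountain_arc tT' (proj2 (fr' r) fr) Vij; first by constructor 2.
    by constructor 3.
  + move=> i j ij ijlr n i_n nj; split=> fn.
      by have := left_fountain_uniq tT fl fn; case: ijlr => [|[]|]; lia.
    by have := right_fountain_uniq tT fr fn; case: ijlr => [|[]|]; lia.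
Qed.
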